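(* Fix $a,b\in\mathbb{N}_0=\{0,1,2,\dots\}$. For every $n\in\mathbb{N}$ let $Q_n(z)$ be a real polynomial (not identically zero) of degree $\le n$ with only nonnegative roots such that $[\![Q_n]\!]_n\to\nu$ weakly, as $n\to\infty$, for some probability measure $\nu$ on $[0,+\infty)$. Assume that $n,\ell\to\infty$ such that $\ell/n\to\kappa>0$ and $1+(a-b)\kappa>0$. Then $$\left[\!\!\left[z^{-\ell(a-b)}\left(z^a\left(\tfrac{d}{dz}\right)^b\right)^\ell Q_n(z)\right]\!\!\right]_n\longrightarrow\nu\boxtimes\nu_{a,b;\kappa}\qquad\text{weakly},$$ where $\nu_{a,b;\kappa}$ is the probability measure on $[0,\infty)$ defined in the context.
   Context: Empirical zero distribution: for a polynomial $Q\not\equiv0$ with $\deg Q\le n$, $$[\![Q]\!]_n:=\frac1n\sum_{z\in\mathbb{C}:Q(z)=0}\delta_z+\frac{n-\deg Q}{n}\delta_\infty,$$ zeros counted with multiplicity; for nonnegative roots $\infty$ is identified with $+\infty$, and $[\![Q]\!]_n$ is a probability measure on $[0,+\infty]$, on which weak convergence is understood (a probability measure on $[0,\infty)$ being viewed as one on $[0,+\infty]$). Here $\ell=\ell(n)$ depends on $n$. The measure $\nu_{a,b;\kappa}$: with $\Delta=a-b$, let $$T_{n,\ell}^{(a,b)}(z)=z^{-\ell\Delta}\,\mathcal{A}_{a,b}^\ell\big((z-1)^n\big),\qquad\mathcal{A}_{a,b}=n^{-b}z^a\left(\tfrac{d}{dz}\right)^b.$$ If $\kappa>0$ and $1+\Delta\kappa>0$,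 then for any $n,\ell\to\infty$ with $\ell/n\to\kappa$ the measures $[\![T_{n,\ell}^{(a,b)}]\!]_n$ converge weakly to a compactly supported probability measure on $[0,\infty)$ depending only on $a,b,\kappa$; this limit is denoted by $\nu_{a,b;\kappa}$. $\boxtimes$ denotes the classical (Voiculescu/Bercovici–Voiculescu) free multiplicative convolution of probability measures on $[0,\infty)$. *)

(* Defs.v *)
From HB Require Import structures.
From mathcomp Require Import all_boot all_order all_algebra.
From mathcomp Require Import polyrcf complex.
From mathcomp Require Import all_classical all_reals all_analysis.
From mathcomp Require Import measurable_realfun.

Set Implicit Arguments.
Unset Strict Implicit.
Unset Printing Implicit Defensive.

Import Order.TTheory GRing.Theory Num.Theory.
Import numFieldNormedType.Exports.

Local Open Scope classical_set_scope.
Local Open Scope ring_scope.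

(* The order of R[i] is partial: 0 <= z says that z is real and nonnegative. *)
Definition nonneg_rooted (R : realType) (p : {poly R}) : Prop :=
  forall z : R[i], root (map_poly (real_complex R) p) z -> 0 <= z.

(* The measure [[p]]_n, for p != 0 of degree at most n, restricted to the
   extended real line; nothing is lost when all the complex zeros are real.
   A nonreal zero is dropped, so it lowers the total mass below 1 and is seen
   by weak_cvg below (test function 1). For p = 0 or n = 0 the value has no
   meaning; only the behaviour as n tends to infinity is ever used. *)
Definition zero_dist (R : realType) (n : nat) (p : {poly R}) :
    {measure set (\bar R) -> \bar R} :=
  let xs := rootsR p in
  mscale (n%:R^-1)%:nng
    (measure_add
      (msum (fun i => mscale (mup xs`_i p)%:R%:nng (dirac (xs`_i)%:E)) (size xs))
      (mscale (n - (size p).-1)%:R%:nng (dirac (+oo%E : \bar R)))).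

(* Continuous functions on the compact space \bar R are bounded. All the
   measures considered live on the closed subset [0, +oo], every continuous
   function on which extends to \bar R, so this is weak convergence there. *)
Definition weak_cvg (R : realType)
    (mu_ : nat -> {measure set (\bar R) -> \bar R})
    (mu : {measure set (\bar R) -> \bar R}) : Prop :=
  forall f : \bar R -> R, continuous f ->
    \int[mu_ n]_x f x @[n --> \oo] --> \int[mu]_x f x.

Lemma measurable_EFinT (R : realType) : measurable_fun setT (@EFin R).
Proof. exact: EFin_measurable. Qed.

HB.instance Definition _ (R : realType) :=
  isMeasurableFun.Build _ _ R (\bar R) (@EFin R) (@measurable_EFinT R).

(* A probability measure on the real line viewed on \bar R. *)
Definition to_ereal (R : realType) (mu : probability R R) :
    {measure set (\bar R) -> \bar R} :=
  distribution mu (@EFin R).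

Definition on_nneg (R : realType) (mu : probability R R) : Prop :=
  mu [set x | 0 <= x] = 1%E.

Definition compact_support (R : realType) (mu : probability R R) : Prop :=
  exists c : R, mu [set x | `|x| <= c] = 1%E.

Definition atom0 (R : realType) (mu : probability R R) : R := fine (mu [set 0]).

Definition psi_transform (R : realType) (mu : probability R R) (z : R) : R :=
  \int[mu]_(t in [set t | 0 <= t]) (z * t / (1 - z * t)).

(* On the half-line z < 0, psi_transform mu is, for mu on [0, +oo[ other than
   the unit mass at 0, an increasing bijection onto ]atom0 mu - 1, 0[; its
   inverse there is chi_transform mu. Outside that interval the values of
   chi_transform and S_transform have no meaning. *)
Definition chi_transform (R : realType) (mu : probability R R) (s : R) : R :=
  get [set z : R | z < 0 /\ psi_transform mu z = s].

Definition S_transform (R : realType) (mu : probability R R) (s : R) : R :=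
  (1 + s) / s * chi_transform mu s.

(* rho is the free multiplicative convolution of mu and nu, all of them on
   [0, +oo[, in the sense of Bercovici and Voiculescu: S-transforms multiply.
   If mu or nu is the unit mass at 0, the interval for s is empty and the
   condition on the atoms makes rho the unit mass at 0. *)
Definition is_free_mult_conv (R : realType) (mu nu rho : probability R R) :
    Prop :=
  [/\ on_nneg rho,
      atom0 rho = Num.max (atom0 mu) (atom0 nu) &
      forall s : R, atom0 rho - 1 < s < 0 ->
        S_transform rho s = S_transform mu s * S_transform nu s].

(* z^(- l (a - b)) (z^a (d/dz)^b)^l p, written as z^(l b) (...) / z^(l a) so
   that no negative exponent occurs; the division is exact, see below. *)
Definition diff_iter (R : realType) (a b l : nat) (p : {poly R}) : {poly R} :=
  ('X^(l * b) * iter l (fun q => 'X^a * q^`(b)) p) %/ 'X^(l * a).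

Definition T_poly (R : realType) (a b n l : nat) : {poly R} :=
  ('X^(l * b) * iter l (fun q => n%:R ^- b *: ('X^a * q^`(b)))
                       (('X - 1) ^+ n)) %/ 'X^(l * a).

Lemma dvdp_Xn_deriv (R : realType) (A B : nat) (p : {poly R}) :
  'X^A %| 'X^B * p -> 'X^A %| 'X^(B.+1) * p^`().
Proof.
have [AB _|BA] := leqP A B.
  by apply/dvdp_mulr/dvdp_exp2l/(leq_trans AB).
have /subnKC <- := BA; set k := (A - B.+1)%N.
rewrite {1}addSnnS {1}exprD dvdp_mul2l ?expf_neq0 ?polyX_eq0//.
move=> /dvdpP[r ->]; rewrite derivM derivXn exprD dvdp_mul2l; last first.
  by rewrite expf_neq0 ?polyX_eq0.
rewrite dvdp_add ?dvdp_mull//; first by rewrite exprS dvdp_mull.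
by rewrite -mulr_natr dvdp_mulr.
Qed.

Lemma dvdp_Xn_iter (R : realType) (c : R) (a b l : nat) (p : {poly R}) :
  'X^(l * a) %| 'X^(l * b) * iter l (fun q => c *: ('X^a * q^`(b))) p.
Proof.
elim: l => [|l IHl]; first by rewrite mul0n dvd1p.
rewrite iterS; move: IHl; set q := iter l _ p => IHl.
have {IHl} dq : 'X^(l * a) %| 'X^(l * b + b) * q^`(b).
  elim: b {q} (l * b)%N q IHl => [|b IHb] B q dB; first by rewrite addn0.
  by rewrite derivSn -addSnnS; apply: IHb; exact: dvdp_Xn_deriv.
rewrite !mulSnr {1}exprD -scalerAr -mul_polyC dvdp_mull// mulrCA.
by rewrite ['X^a * _]mulrC dvdp_mul.
Qed.

Lemma diff_iterE (R : realType) (a b l : nat) (p : {poly R}) :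
  diff_iter a b l p * 'X^(l * a) =
  'X^(l * b) * iter l (fun q => 'X^a * q^`(b)) p.
Proof.
apply: divpK; have := dvdp_Xn_iter 1 a b l p.
by rewrite (eq_iter (f' := fun q => 'X^a * q^`(b)))// => q; rewrite scale1r.
Qed.

Lemma T_polyE (R : realType) (a b n l : nat) :
  T_poly R a b n l * 'X^(l * a) =
  'X^(l * b) * iter l (fun q => n%:R ^- b *: ('X^a * q^`(b))) (('X - 1) ^+ n).
Proof. exact/divpK/dvdp_Xn_iter. Qed.

(* m is nu_(a,b;kappa) *)
Definition is_nu (R : realType) (a b : nat) (kappa : R) (m : probability R R) :
    Prop :=
  [/\ on_nneg m, compact_support m &
      forall ell : nat -> nat,
        ell n @[n --> \oo] --> \oo ->
        (ell n)%:R / n%:R @[n --> \oo] --> kappa ->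
        weak_cvg (fun n => zero_dist n (T_poly R a b n (ell n))) (to_ereal m)].

(* Main.v *)
Require Import Defs.
From HB Require Import structures.
From mathcomp Require Import all_boot all_order all_algebra.
From mathcomp Require Import polyrcf complex.
From mathcomp Require Import all_classical all_reals all_analysis.
From mathcomp Require Import measurable_realfun.
From mathcomp Require Import ring lra zify.

Set Implicit Arguments.
Unset Strict Implicit.
Unset Printing Implicit Defensive.

Import Order.TTheory GRing.Theory Num.Theory.
Import numFieldNormedType.Exports.

Local Open Scope classical_set_scope.
Local Open Scope ring_scope.

(** The operator acts diagonally on monomials: it multiplies the coefficient of
z^k by a number c_k that does not depend on the polynomial. Applied to
(z-1)^n it gives a polynomial T_n, and the identity
   [z^k] D(Q_n) * binomial(n,k) = const * [z^k] Q_n * [z^k] T_n  (up to sign)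
says that D(Q_n) is the finite free multiplicative convolution of Q_n and T_n.
So it suffices to show that finite free multiplicative convolution converges
to the free one, given that the zeros of T_n converge to nu_(a,b;kappa).

All polynomials involved have nonnegative zeros only: a Gauss-Lucas argument
shows that differentiation preserves this ([nonneg_split_deriv]). Writing
w = 1/(1+t) for each zero t in [0,+oo], the polynomial p(-X) is proportional to
the product of the factors 1-w+wX, the generating polynomial of a sum K of
independent Bernoulli variables. Its coefficients e_k are log-concave, and
tilting by x^k gives K the mean n m(x), where m(x) is the average of x/(x+t)
over the zeros. A log-concave law lives near its mean, so up to a factor 1+eps
the ratio e_k/e_(k+1) is above x when m(x) < k/n and below x when m(x) > k/n
([coef_bern_ge_of_mean], [coef_bern_le_of_mean]). In the limit, e_k/e_(k+1) with
k/n near alpha tends to the solution x of phi(x) = alpha, where phi(x) is the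
integral of x/(x+t) against the limit law. This is the S-transform in disguise:
S(alpha-1) = alpha/((1-alpha)x) ([S_transform_phi]).

For the convolution, the ratios multiply, with an extra factor
(n-k)/(k+1) -> (1-alpha)/alpha coming from the binomials. Reading the argument
backwards, the averages m(x) for D(Q_n) converge to alpha at the point
X = y z (1-alpha)/alpha, where phi takes the value alpha at y for nu and at z
for nu_(a,b;kappa) ([free_kmean_cvg]). Multiplicativity of S-transforms is
precisely this formula for X.

It remains to produce the limit law. The points X have an accumulation point
x0, and convergence of the averages of x/(x+t) at points x accumulating at x0
forces convergence of all moments of the numbers p = x0/(x0+t) in [0,1]
([moments_of_kernel_means]). Convergent moments make the quantile functions of
these lists converge outside a countable set ([quantile_cvg_countable]), and the
law of the limiting quantile function is the weak limit ([moment_limit]). *)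

(** * Generating polynomials of Bernoulli sums *)

(** The probability generating function of a sum of independent Bernoulli
    variables with parameters [ws]. *)
Definition bern_poly (R : realFieldType) (ws : seq R) : {poly R} :=
  \prod_(w <- ws) ((1 - w)%:P + w *: 'X).

(** The mean of that sum when the probability of k is reweighted by x^k. *)
Definition bern_mean (R : realFieldType) (ws : seq R) (x : R) : R :=
  \sum_(w <- ws) w * x / (1 - w + w * x).

Definition in01 (R : realFieldType) (ws : seq R) := all (fun w => 0 <= w <= 1) ws.

Lemma bern_poly_cons (R : realFieldType) (w : R) ws :
  bern_poly (w :: ws) = ((1 - w)%:P + w *: 'X) * bern_poly ws.
Proof. by rewrite /bern_poly big_cons. Qed.

Lemma coef_bern_cons (R : realFieldType) (w : R) ws k :
  (bern_poly (w :: ws))`_k.+1 =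
  (1 - w) * (bern_poly ws)`_k.+1 + w * (bern_poly ws)`_k.
Proof. by rewrite bern_poly_cons mulrDl coefD coefCM -scalerAl coefZ coefXM. Qed.

Lemma coef_bern_cons0 (R : realFieldType) (w : R) ws :
  (bern_poly (w :: ws))`_0 = (1 - w) * (bern_poly ws)`_0.
Proof.
by rewrite bern_poly_cons mulrDl coefD coefCM -scalerAl coefZ coefXM mulr0 addr0.
Qed.

Lemma coef_bern_ge0 (R : realFieldType) (ws : seq R) k :
  in01 ws -> 0 <= (bern_poly ws)`_k.
Proof.
elim: ws k => [|w ws IH] k /=; first by rewrite /bern_poly big_nil coef1; case: eqP.
move=> /andP[/andP[w0 w1] ws01]; have {}IH j := IH j ws01.
case: k => [|k]; rewrite ?coef_bern_cons ?coef_bern_cons0.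
  by rewrite mulr_ge0// subr_ge0.
by rewrite addr_ge0// mulr_ge0// subr_ge0.
Qed.

Lemma size_bern_poly (R : realFieldType) (ws : seq R) :
  (size (bern_poly ws) <= (size ws).+1)%N.
Proof.
elim: ws => [|w ws IH]; first by rewrite /bern_poly big_nil size_poly1.
apply/leq_sizeP => j /= lj; case: j lj => // j lj.
by rewrite coef_bern_cons !(leq_sizeP _ _ IH) ?mulr0 ?addr0//; lia.
Qed.

Lemma bern_poly_gt0 (R : realFieldType) (ws : seq R) x :
  in01 ws -> 0 < x -> 0 < (bern_poly ws).[x].
Proof.
move=> + x0; elim: ws => [|w ws IH] /=; first by rewrite /bern_poly big_nil hornerC.
move=> /andP[/andP[w0 w1] /IH G0]; rewrite bern_poly_cons hornerM mulr_gt0//.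
rewrite hornerD hornerC hornerZ hornerX; nra.
Qed.

(** Log-concavity in a form that also excludes internal zeros, which is why two
    indices [i <= j] appear; this form passes through a multiplication by
    1-w+wX. *)
Lemma coef_bern_log_concave (R : realFieldType) (ws : seq R) i j :
  in01 ws -> (i <= j)%N ->
  (bern_poly ws)`_i * (bern_poly ws)`_j.+1 <=
  (bern_poly ws)`_i.+1 * (bern_poly ws)`_j.
Proof.
elim: ws i j => [|w ws IH] i j.
  by move=> _ _; rewrite /bern_poly big_nil !coef1 /= mulr0 mul0r.
move=> /= /andP[/andP[w0 w1] ws01] ij.
have e0 k := coef_bern_ge0 k ws01.
have {}IH i' j' := IH i' j' ws01.
have w1' : 0 <= 1 - w by rewrite subr_ge0.
case: j ij => [|j] ij.
  move: ij; rewrite leqn0 => /eqP ->.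
  by rewrite mulrC.
case: i ij => [|i] ij; rewrite !coef_bern_cons ?coef_bern_cons0.
  set e := bern_poly ws in e0 IH *.
  have H1 := IH 0%N j.+1 isT; have H2 := IH 0%N j isT.
  have := mulr_ge0 w1' w1'; have := mulr_ge0 w1' w0; have := mulr_ge0 w0 w0.
  set v := 1 - w => ww vw vv; rewrite -subr_ge0.
  (* the difference is a combination of smaller instances and products *)
  rewrite [leRHS](_ : _ = v * v * (e`_1 * e`_j.+1 - e`_0 * e`_j.+2)
    + v * w * (e`_1 * e`_j) + w * w * (e`_0 * e`_j)); last by ring.
  by rewrite !addr_ge0// mulr_ge0 ?subr_ge0// mulr_ge0.
set e := bern_poly ws in e0 IH *.
have ij' : (i <= j)%N by [].
have H1 := IH i.+1 j.+1 ij; have H2 := IH i j ij'.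
have H3 : e`_i * e`_j.+2 <= e`_i.+2 * e`_j.
  have [h1 h2] := (IH i j.+1 (leqW ij'), IH i.+1 j).
  move: ij; rewrite leq_eqVlt => /orP[/eqP [<-]|ij]; last first.
    exact: le_trans h1 (h2 ij).
  by rewrite mulrC.
have := mulr_ge0 w1' w1'; have := mulr_ge0 w1' w0; have := mulr_ge0 w0 w0.
set v := 1 - w => ww vw vv; rewrite -subr_ge0.
rewrite [leRHS](_ : _ = v * w * (e`_i.+2 * e`_j - e`_i * e`_j.+2)
  + w * w * (e`_i.+1 * e`_j - e`_i * e`_j.+1)
  + v * v * (e`_i.+2 * e`_j.+1 - e`_i.+1 * e`_j.+2)); last by ring.
by rewrite !addr_ge0 ?mulr_ge0 ?subr_ge0 // mulr_ge0 ?subr_ge0.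
Qed.

(** The support of a log-concave sequence is an interval: two positive entries
    at distance at least 2 force their inner neighbours to be positive. *)
Lemma coef_bern_gt0 (R : realFieldType) (ws : seq R) i j k :
  in01 ws -> (i <= k <= j)%N -> 0 < (bern_poly ws)`_i ->
  0 < (bern_poly ws)`_j -> 0 < (bern_poly ws)`_k.
Proof.
move=> ws01; have [m] := ubnP (j - i); elim: m i j => // m IH i j ji ikj ei ej.
have e0 l := coef_bern_ge0 l ws01.
have [<-//|ik] := eqVneq i k; have [<-//|jk] := eqVneq j k.
case: j => [|j] in ji ikj ej jk *; first lia.
have ij : (i <= j)%N by lia.
have := lt_le_trans (mulr_gt0 ei ej) (coef_bern_log_concave ws01 ij).
move=> e2; apply: (IH i.+1 j); [lia|lia| |].
  by rewrite lt0r e0 andbT; apply: contraTneq e2 => ->; rewrite mul0r ltxx.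
by rewrite lt0r e0 andbT; apply: contraTneq e2 => ->; rewrite mulr0 ltxx.
Qed.

(** Logarithmic derivative of the product. *)
Lemma bern_mean_deriv (R : realFieldType) (ws : seq R) x :
  in01 ws -> 0 < x ->
  x * (bern_poly ws)^`().[x] = bern_mean ws x * (bern_poly ws).[x].
Proof.
move=> + x0; elim: ws => [|w ws IH].
  by rewrite /bern_poly /bern_mean !big_nil mul0r derivC hornerC mulr0.
move=> /= /andP[/andP[w0 w1] /IH {}IH].
rewrite bern_poly_cons derivM hornerD !hornerM /bern_mean big_cons -/(bern_mean _ _).
rewrite derivD derivC derivZ derivX add0r !(hornerD, hornerM, hornerZ, hornerX, hornerC) ?mulr1.
have d0 : 1 - w + w * x != 0 by apply: lt0r_neq0; nra.
rewrite mulrDr [x * (_ * _^`().[x])]mulrCA IH.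
by field.
Qed.

Lemma bern_poly_horner (R : realFieldType) (ws : seq R) x N :
  (size ws < N)%N -> (bern_poly ws).[x] = \sum_(j < N) (bern_poly ws)`_j * x ^+ j.
Proof. by move=> lN; apply/horner_coef_wide/(leq_trans (size_bern_poly _)). Qed.

Lemma bern_mean_sum (R : realFieldType) (ws : seq R) x N :
  in01 ws -> 0 < x -> (size ws < N)%N ->
  \sum_(j < N) j%:R * ((bern_poly ws)`_j * x ^+ j) =
  bern_mean ws x * (bern_poly ws).[x].
Proof.
move=> ws01 x0 lN; rewrite -bern_mean_deriv//.
case: N lN => // N; rewrite ltnS => lN.
rewrite big_ord_recl mul0r add0r (@horner_coef_wide _ N); last first.
  apply/leq_sizeP => j Nj; rewrite coef_deriv (leq_sizeP _ _ (size_bern_poly ws)) ?mul0rn//; lia.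
rewrite mulr_sumr; apply: eq_bigr => i _.
by rewrite coef_deriv lift0 exprS -mulr_natl; ring.
Qed.

(** With S the sum of (j-k)^+ u_j, shifting the index by one turns the decay
    into (1+eps) S <= S + G, where G is the total mass; so S <= G/eps, without
    summing a geometric series. *)
Lemma tail_decay_mean (R : realFieldType) (u : nat -> R) (N k : nat) (eps : R) :
  0 < eps -> (forall j, 0 <= u j) ->
  (forall j, (k <= j)%N -> (1 + eps) * u j.+1 <= u j) ->
  \sum_(j < N) j%:R * u j <= (k%:R + eps^-1) * \sum_(j < N) u j.
Proof.
move=> eps0 u0 decay.
set G := \sum_(j < N) u j; set S := \sum_(j < N) (j - k)%:R * u j.
have H1 : \sum_(j < N) j%:R * u j <= k%:R * G + S.
  rewrite mulr_sumr -big_split /=; apply: ler_sum => j _.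
  rewrite -mulrDl ler_wpM2r// -natrD ler_nat; lia.
have H2 : (1 + eps) * S <= S + G.
  rewrite /S /G; case: N {G S H1} => [|N]; first by rewrite !big_ord0 mulr0 addr0.
  rewrite [X in _ * X]big_ord_recl /= sub0n mul0r add0r mulr_sumr.
  apply: (@le_trans _ _ (\sum_(j < N) ((j - k)%:R * u j + u j))).
    apply: ler_sum => j _; rewrite ?lift0.
    have [kj|jk] := leqP k j; last first.
      rewrite (_ : (j.+1 - k)%N = 0%N) ?mul0r ?mulr0; last by lia.
      by rewrite addr_ge0// mulr_ge0.
    rewrite subSn// -natr1 mulrCA -[X in _ <= _ + X]mul1r -mulrDl.
    by rewrite ler_wpM2l// ?decay// addr_ge0.
  rewrite big_split /= !big_ord_recr /= lerD// lerDl// mulr_ge0//.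
apply: le_trans H1 _; rewrite mulrDl lerD2l -(ler_pM2l eps0) mulrA mulfV ?lt0r_neq0//.
by move: H2; rewrite mulrDl mul1r lerD2l mul1r.
Qed.

(** Mirror image of [tail_decay_mean], with the sum of (k+1-j)^+ u_j. *)
Lemma head_growth_mean (R : realFieldType) (u : nat -> R) (N k : nat) (eps : R) :
  0 < eps -> (forall j, 0 <= u j) -> (k.+1 < N)%N ->
  (forall j, (j <= k)%N -> (1 + eps) * u j <= u j.+1) ->
  (k.+1%:R - eps^-1) * \sum_(j < N) u j <= \sum_(j < N) j%:R * u j.
Proof.
move=> eps0 u0 kN growth.
set G := \sum_(j < N) u j; set S := \sum_(j < N) (k.+1 - j)%:R * u j.
have H1 : k.+1%:R * G - S <= \sum_(j < N) j%:R * u j.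
  rewrite mulr_sumr lerBlDr -big_split /=; apply: ler_sum => j _.
  rewrite -mulrDl ler_wpM2r// -natrD ler_nat; lia.
have H2 : (1 + eps) * S <= S + G.
  rewrite /S mulr_sumr.
  apply: (@le_trans _ _ (\sum_(j < N) (k.+1 - j)%:R * u j.+1)).
    apply: ler_sum => j _; have [jk|kj] := leqP j k.
      by rewrite mulrCA ler_wpM2l// growth.
    by rewrite (_ : (k.+1 - j)%N = 0%N) ?mul0r ?mulr0//; lia.
  apply: (@le_trans _ _ (\sum_(j < N.+1) (k.+2 - j)%:R * u j)).
    rewrite big_ord_recl /=; set A := (X in _ <= X + _).
    by rewrite ler_wpDl ?mulr_ge0// ler_sum.
  rewrite big_ord_recr /= (_ : (k.+2 - N)%N = 0%N) ?mul0r ?addr0; last by lia.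
  rewrite -big_split /=; apply: ler_sum => j _.
  rewrite -[X in _ <= _ + X]mul1r -mulrDl ler_wpM2r// natr1 ler_nat; lia.
apply: le_trans H1; rewrite mulrBl lerD2l lerN2 -(ler_pM2l eps0) mulrA mulfV ?lt0r_neq0//.
by move: H2; rewrite mulrDl mul1r lerD2l mul1r.
Qed.

(** By log-concavity, a ratio bound at [k] propagates to all larger indices, so
    the reweighted law decays geometrically beyond [k]. *)
Lemma bern_mean_le (R : realFieldType) (ws : seq R) (x eps : R) k :
  in01 ws -> 0 < x -> 0 < eps -> 0 < (bern_poly ws)`_k ->
  (1 + eps) * x * (bern_poly ws)`_k.+1 <= (bern_poly ws)`_k ->
  bern_mean ws x <= k%:R + eps^-1.
Proof.
move=> ws01 x0 eps0 ek0 ek; have e0 j := coef_bern_ge0 j ws01.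
have decay j : (k <= j)%N ->
    (1 + eps) * ((bern_poly ws)`_j.+1 * x ^+ j.+1) <= (bern_poly ws)`_j * x ^+ j.
  move=> kj; rewrite exprS !mulrA ler_wpM2r ?exprn_ge0 ?(ltW x0)//.
  rewrite -(ler_pM2l ek0).
  have xe : 0 <= (1 + eps) * x by rewrite mulr_ge0 ?addr_ge0 ?ltW.
  have := ler_wpM2l xe (coef_bern_log_concave ws01 kj).
  have := ler_wpM2r (e0 j) ek; lra.
have := tail_decay_mean (size ws).+1 eps0 _ decay.
rewrite (bern_mean_sum ws01 x0 (ltnSn _)) -(bern_poly_horner _ (ltnSn _)).
rewrite ler_pM2r ?bern_poly_gt0//; apply=> j.
by rewrite mulr_ge0// exprn_ge0// ltW.
Qed.

(** The index [d] makes sure that [k] is not beyond the support, where both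
    sides of the ratio bound vanish and carry no information. *)
Lemma bern_mean_ge (R : realFieldType) (ws : seq R) (x eps : R) k d :
  in01 ws -> 0 < x -> 0 < eps -> (k < d)%N -> 0 < (bern_poly ws)`_d ->
  (1 + eps) * (bern_poly ws)`_k <= x * (bern_poly ws)`_k.+1 ->
  k.+1%:R - eps^-1 <= bern_mean ws x.
Proof.
move=> ws01 x0 eps0 kd ed ek; have e0 j := coef_bern_ge0 j ws01.
have dws : (d <= size ws)%N.
  rewrite leqNgt; apply: contraTN ed => wsd.
  by rewrite (leq_sizeP _ _ (size_bern_poly ws)) ?ltxx.
have growth j : (j <= k)%N ->
    (1 + eps) * ((bern_poly ws)`_j * x ^+ j) <= (bern_poly ws)`_j.+1 * x ^+ j.+1.
  move=> jk; rewrite exprS !mulrA ler_wpM2r ?exprn_ge0 ?(ltW x0)//.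
  (* then e_j = 0 too: otherwise e_j, e_d > 0 around an internal zero *)
  have [ek1|ek1] := eqVneq ((bern_poly ws)`_k.+1) 0.
    have [->|ej] := eqVneq ((bern_poly ws)`_j) 0.
      by rewrite mulr0 mulr_ge0// ltW.
    have : 0 < (bern_poly ws)`_k.+1.
      by apply: (@coef_bern_gt0 _ _ j d) => //; [lia | rewrite lt0r ej e0].
    by rewrite ek1 ltxx.
  have ek0 : 0 < (bern_poly ws)`_k.+1 by rewrite lt0r ek1 e0.
  rewrite -(ler_pM2l ek0).
  have xe : 0 <= 1 + eps by rewrite addr_ge0 ?ltW.
  have := ler_wpM2l xe (coef_bern_log_concave ws01 jk).
  have := ler_wpM2r (e0 j.+1) ek; lra.
have := head_growth_mean (N := (size ws).+1) eps0 _ _ growth.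
rewrite (bern_mean_sum ws01 x0 (ltnSn _)) -(bern_poly_horner _ (ltnSn _)).
rewrite ler_pM2r ?bern_poly_gt0//; apply; last by lia.
by move=> j; rewrite mulr_ge0// exprn_ge0// ltW.
Qed.

(** Contrapositive of [bern_mean_le]: the mean locates the index at which the
    coefficient ratio crosses [x]. *)
Lemma coef_bern_le_of_mean (R : realFieldType) (ws : seq R) (x eps : R) k :
  in01 ws -> 0 < x -> 0 < eps -> k%:R + eps^-1 < bern_mean ws x ->
  (bern_poly ws)`_k <= (1 + eps) * x * (bern_poly ws)`_k.+1.
Proof.
move=> ws01 x0 eps0 mk; rewrite leNgt; apply: contraTN mk => ek.
rewrite -leNgt; apply: bern_mean_le => //; last exact: ltW.
apply: le_lt_trans ek; rewrite !mulr_ge0 ?addr_ge0 ?coef_bern_ge0//; exact: ltW.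
Qed.

Lemma coef_bern_ge_of_mean (R : realFieldType) (ws : seq R) (x eps : R) k :
  in01 ws -> 0 < x -> 0 < eps -> bern_mean ws x < k.+1%:R - eps^-1 ->
  x * (bern_poly ws)`_k.+1 <= (1 + eps) * (bern_poly ws)`_k.
Proof.
move=> ws01 x0 eps0 mk; rewrite leNgt; apply: contraTN mk => ek.
rewrite -leNgt; apply: (@bern_mean_ge _ _ _ _ _ k.+1) => //; last exact: ltW.
rewrite -(pmulr_rgt0 _ x0); apply: le_lt_trans ek.
by rewrite mulr_ge0 ?addr_ge0 ?coef_bern_ge0//; exact: ltW.
Qed.

(** A variable cannot always stay at or below a level smaller than its mean. *)
Lemma coef_bern_gt0_of_mean (R : realFieldType) (ws : seq R) (x : R) k :
  in01 ws -> 0 < x -> k%:R < bern_mean ws x ->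
  exists2 d, (k < d)%N & 0 < (bern_poly ws)`_d.
Proof.
move=> ws01 x0 mk; have e0 j := coef_bern_ge0 j ws01.
have [/existsP[d /andP[kd ed]]|H] :=
  boolP [exists d : 'I_(size ws).+1, (k < d)%N && (0 < (bern_poly ws)`_d)].
  by exists (nat_of_ord d).
exfalso; move: mk; apply/negP; rewrite -leNgt.
rewrite -(ler_pM2r (bern_poly_gt0 ws01 x0)) -(bern_mean_sum ws01 x0 (ltnSn _)).
rewrite (bern_poly_horner _ (ltnSn _)) mulr_sumr; apply: ler_sum => j _.
move: H; rewrite negb_exists => /forallP/(_ j); rewrite negb_and -leqNgt -leNgt.
have u0 : 0 <= (bern_poly ws)`_j * x ^+ j by rewrite mulr_ge0// exprn_ge0// ltW.
case/orP => [jk|ej]; first by rewrite ler_wpM2r// ler_nat.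
have -> : (bern_poly ws)`_j = 0 by apply/le_anti; rewrite ej e0.
by rewrite mul0r !mulr0.
Qed.

(** The ratio bounds of [coef_bern_ge_of_mean] hold from [k] on, so positivity
    can be transported downwards from [d] to [k]. *)
Lemma coef_bern_gt0_of_mean_lt (R : realFieldType) (ws : seq R) (x eps : R) k d :
  in01 ws -> 0 < x -> 0 < eps -> bern_mean ws x < k.+1%:R - eps^-1 ->
  (k <= d)%N -> 0 < (bern_poly ws)`_d -> 0 < (bern_poly ws)`_k.
Proof.
move=> ws01 x0 eps0 mk kd; elim: d kd => [|d IH]; first by rewrite leqn0 => /eqP ->.
rewrite leq_eqVlt => /orP[/eqP ->//|kd] ed; apply: IH => //.
have : 0 < (1 + eps) * (bern_poly ws)`_d.
  apply: lt_le_trans (coef_bern_ge_of_mean ws01 x0 eps0 _).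
    by rewrite mulr_gt0.
  by apply: lt_le_trans mk _; rewrite lerD2r ler_nat; lia.
by rewrite pmulr_rgt0// addr_gt0.
Qed.

(** The degree [n] multiplicative convolution of Szego and Walsh, in terms of
    the coefficients: dividing by the binomials makes it a pointwise product.
    The constant absorbs the normalization of generating functions at 1. *)
Definition finite_free_mult (R : realFieldType) (n : nat) (us vs ws : seq R) :=
  exists2 C : R, 0 < C & forall k, (k <= n)%N ->
    'C(n, k)%:R * (bern_poly ws)`_k = C * ((bern_poly us)`_k * (bern_poly vs)`_k).

(** The coefficient ratios of the convolution are the products of those of the
    factors times (n-k)/(k+1); bounding the former from above at a single
    index bounds the mean from below. *)
Lemma finite_free_mult_mean_ge (R : realFieldType) (n : nat) (us vs ws : seq R)
    (x y z eps : R) (k d : nat) :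
  in01 us -> in01 vs -> in01 ws -> finite_free_mult n us vs ws ->
  0 < x -> 0 < y -> 0 < z -> 0 < eps -> (k < n)%N ->
  (k < d)%N -> 0 < (bern_poly ws)`_d ->
  k%:R + eps^-1 < bern_mean us y -> k%:R + eps^-1 < bern_mean vs z ->
  (1 + eps) ^+ 3 * (y * z * (n - k)%:R) <= x * k.+1%:R ->
  k.+1%:R - eps^-1 <= bern_mean ws x.
Proof.
move=> us01 vs01 ws01 [C C0 HC] x0 y0 z0 eps0 kn kd ed mu mv xyz.
apply: bern_mean_ge kd ed _ => //.
have He := ltW eps0; have Hy := ltW y0; have Hz := ltW z0.
have b0 : 0 < ('C(n, k)%:R : R) by rewrite ltr0n bin_gt0 ltnW.
have b1 : 0 < ('C(n, k.+1)%:R : R) by rewrite ltr0n bin_gt0.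
have bE : k.+1%:R * 'C(n, k.+1)%:R = (n - k)%:R * 'C(n, k)%:R :> R.
  by rewrite -!natrM mul_bin_left.
have := ler_pM _ _ (coef_bern_le_of_mean us01 y0 eps0 mu)
  (coef_bern_le_of_mean vs01 z0 eps0 mv).
rewrite !coef_bern_ge0// => /(_ isT isT).
rewrite -(ler_pM2l C0) -(HC k (ltnW kn)).
rewrite [leRHS](_ : _ = (1 + eps) ^+ 2 * (y * z) *
   (C * ((bern_poly us)`_k.+1 * (bern_poly vs)`_k.+1))); last by ring.
rewrite -(HC _ kn) => H.
rewrite -(ler_pM2l b0) mulrCA.
apply: le_trans (ler_wpM2l (addr_ge0 ler01 He) H) _.
rewrite -(ler_pM2l (_ : 0 < k.+1%:R :> R)) ?ltr0n//.
rewrite [leLHS](_ : _ = (1 + eps) ^+ 3 * (y * z) * (k.+1%:R * 'C(n, k.+1)%:R)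
   * (bern_poly ws)`_k.+1); last by ring.
rewrite bE.
rewrite [leLHS](_ : _ = (1 + eps) ^+ 3 * (y * z * (n - k)%:R) * ('C(n, k)%:R
   * (bern_poly ws)`_k.+1)); last by ring.
rewrite [leRHS](_ : _ = x * k.+1%:R * ('C(n, k)%:R * (bern_poly ws)`_k.+1)); last by ring.
by rewrite ler_wpM2r// mulr_ge0 ?coef_bern_ge0.
Qed.

Lemma finite_free_mult_mean_le (R : realFieldType) (n : nat) (us vs ws : seq R)
    (x y z eps : R) (k du dv : nat) :
  in01 us -> in01 vs -> in01 ws -> finite_free_mult n us vs ws ->
  0 < x -> 0 < y -> 0 < z -> 0 < eps -> (k < n)%N ->
  (k <= du)%N -> 0 < (bern_poly us)`_du -> (k <= dv)%N -> 0 < (bern_poly vs)`_dv ->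
  bern_mean us y < k.+1%:R - eps^-1 -> bern_mean vs z < k.+1%:R - eps^-1 ->
  (1 + eps) ^+ 3 * (x * k.+1%:R) <= y * z * (n - k)%:R ->
  bern_mean ws x <= k%:R + eps^-1.
Proof.
move=> us01 vs01 ws01 [C C0 HC] x0 y0 z0 eps0 kn kdu eu kdv ev mu mv xyz.
have He := ltW eps0; have Hy := ltW y0; have Hz := ltW z0.
have uk := coef_bern_gt0_of_mean_lt us01 y0 eps0 mu kdu eu.
have vk := coef_bern_gt0_of_mean_lt vs01 z0 eps0 mv kdv ev.
have b0 : 0 < ('C(n, k)%:R : R) by rewrite ltr0n bin_gt0 ltnW.
have b1 : 0 < ('C(n, k.+1)%:R : R) by rewrite ltr0n bin_gt0.
have bE : k.+1%:R * 'C(n, k.+1)%:R = (n - k)%:R * 'C(n, k)%:R :> R.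
  by rewrite -!natrM mul_bin_left.
apply: bern_mean_le => //.
  by rewrite -(pmulr_rgt0 _ b0) (HC k (ltnW kn)) !mulr_gt0.
have := ler_pM _ _ (coef_bern_ge_of_mean us01 y0 eps0 mu)
  (coef_bern_ge_of_mean vs01 z0 eps0 mv).
rewrite !mulr_ge0 ?coef_bern_ge0// => /(_ isT isT).
rewrite -(ler_pM2l C0).
rewrite [leRHS](_ : _ = (1 + eps) ^+ 2 *
   (C * ((bern_poly us)`_k * (bern_poly vs)`_k))); last by ring.
rewrite [leLHS](_ : _ = y * z *
   (C * ((bern_poly us)`_k.+1 * (bern_poly vs)`_k.+1))); last by ring.
rewrite -(HC _ kn) -(HC k (ltnW kn)) => H.
have e2 : 0 < (1 + eps) ^+ 2 by rewrite exprn_gt0// addr_gt0.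
rewrite -(ler_pM2l b0) -(ler_pM2l e2).
apply: le_trans H.
rewrite -(ler_pM2l (_ : 0 < k.+1%:R :> R)) ?ltr0n//.
rewrite [leRHS](_ : _ = (y * z) * (k.+1%:R * 'C(n, k.+1)%:R)
   * (bern_poly ws)`_k.+1); last by ring.
rewrite bE.
rewrite [leRHS](_ : _ = (y * z * (n - k)%:R) * ('C(n, k)%:R
   * (bern_poly ws)`_k.+1)); last by ring.
rewrite [leLHS](_ : _ = (1 + eps) ^+ 3 * (x * k.+1%:R) * ('C(n, k)%:R
   * (bern_poly ws)`_k.+1)); last by ring.
by rewrite ler_wpM2r// mulr_ge0 ?coef_bern_ge0.
Qed.

(** * Nonnegative roots and coefficients under the differential operator *)

(** The zero polynomial qualifies, with [c = 0]: this makes the property stable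
    under differentiation. *)
Definition nonneg_split (R : realType) (p : {poly R}) : Prop :=
  exists (c : R) (rs : seq R),
    all (fun r => 0 <= r) rs /\ p = c *: \prod_(r <- rs) ('X - r%:P).

Lemma nonneg_rooted_split (R : realType) (p : {poly R}) :
  nonneg_rooted p -> nonneg_split p.
Proof.
move=> p_nonneg; have [rs ps] := closed_field_poly_normal (map_poly (real_complex R) p).
have [->|p0] := eqVneq p 0; first by exists 0, [::]; rewrite scale0r.
have rs_ge0 z : z \in rs -> 0 <= z.
  move=> zrs; apply: p_nonneg.
  by rewrite ps rootZ ?root_prod_XsubC// lead_coef_eq0 map_poly_eq0.
exists (lead_coef p), (map (@complex.Re R) rs); split.
  by apply/allP => _ /mapP[z /rs_ge0 z0 ->]; move: z0; rewrite lecE => /andP[].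
apply: (@map_poly_inj _ _ (real_complex R)); rewrite ps.
rewrite linearZ /= lead_coef_map rmorph_prod/= big_map; congr (_ *: _).
apply: eq_big_seq => z /rs_ge0 z0; rewrite rmorphB/= map_polyX map_polyC/=.
congr (_ - _%:P); case: z z0 => a b; rewrite lecE /= => /andP[/eqP -> _].
by [].
Qed.

Lemma nonneg_split_rooted (R : realType) (p : {poly R}) :
  p != 0 -> nonneg_split p -> nonneg_rooted p.
Proof.
move=> p0 [c [rs [rs0 pE]]] z; rewrite pE linearZ /= rootZ; last first.
  by apply: contraNneq p0 => c0; rewrite pE (complexI c0) scale0r.
rewrite rmorph_prod/=.
under eq_bigr do rewrite rmorphB/= map_polyX map_polyC/=.
rewrite -(big_map (real_complex R) xpredT (fun r => 'X - r%:P)) root_prod_XsubC.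
by move=> /mapP[r /(allP rs0) r0 ->]; rewrite ler0c.
Qed.

(** Off the roots, P'/P is the sum of the 1/(z-r). *)
Lemma log_deriv_prod_XsubC (F : fieldType) (rs : seq F) (z : F) :
  z \notin rs ->
  (\prod_(r <- rs) ('X - r%:P))^`().[z] =
  (\prod_(r <- rs) ('X - r%:P)).[z] * \sum_(r <- rs) (z - r)^-1.
Proof.
elim: rs => [|r rs IH]; first by rewrite !big_nil derivC hornerC mulr0.
rewrite inE negb_or => /andP[zr /IH {}IH]; rewrite !big_cons derivM derivXsubC mul1r.
rewrite hornerD !hornerM hornerXsubC IH mulrDr mulrAC mulfV ?subr_eq0// mul1r.
by rewrite mulrA.
Qed.

(** Gauss-Lucas: at a zero z of P' which is not a zero of P the sum of the
    1/(z-r) vanishes. If z is not real, all these terms have imaginary part of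
    the sign opposite to that of Im z; if z is negative, they are all
    negative. *)
Lemma nonneg_split_deriv (R : realType) (p : {poly R}) :
  nonneg_split p -> nonneg_split p^`().
Proof.
move=> [c [rs [rs0 ->]]]; rewrite derivZ.
case: rs rs0 => [|r0 rs] rs0.
  by exists 0, [::]; rewrite big_nil derivC scaler0 scale0r.
set rs' := r0 :: rs in rs0 *.
suff : nonneg_split (\prod_(r <- rs') ('X - r%:P))^`().
  move=> [d [ts [ts0 ->]]]; exists (c * d), ts; split=> //.
  by rewrite scalerA.
apply: nonneg_rooted_split => -[a b].
rewrite -deriv_map rmorph_prod/=.
under eq_bigr do rewrite rmorphB/= map_polyX map_polyC/=.
rewrite -(big_map (real_complex R) xpredT (fun r => 'X - r%:P)).
have [/mapP[r /(allP rs0) r0' ->]|zrs] :=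
  boolP ((a +i* b)%C \in map (real_complex R) rs'); first by rewrite ler0c.
rewrite rootE log_deriv_prod_XsubC// mulf_eq0.
rewrite -/(root _ _) root_prod_XsubC (negPf zrs) orFb big_map.
have ReD (x y : R[i]) : complex.Re (x + y) = complex.Re x + complex.Re y.
  by case: x; case: y.
have ImD (x y : R[i]) : complex.Im (x + y) = complex.Im x + complex.Im y.
  by case: x; case: y.
set S := \sum_(r <- rs') _ => /eqP S0.
have ReS : complex.Re S = \sum_(r <- rs') (a - r) / ((a - r) ^+ 2 + b ^+ 2).
  rewrite /S; elim: (rs') => [|r ts IH]; first by rewrite !big_nil.
  by rewrite !big_cons ReD IH /= subr0.
have ImS : complex.Im S = \sum_(r <- rs') - (b / ((a - r) ^+ 2 + b ^+ 2)).
  rewrite /S; elim: (rs') => [|r ts IH]; first by rewrite !big_nil.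
  by rewrite !big_cons ImD IH /= subr0.
rewrite S0 /= in ReS ImS; rewrite lecE /=.
have [b0|b0] := eqVneq b 0; last first.
  exfalso; have : 0 < \sum_(r <- rs') b * (b / ((a - r) ^+ 2 + b ^+ 2)).
    rewrite /rs' big_cons ltr_pwDl//.
      rewrite mulrA divr_gt0 -?expr2 ?exprn_even_gt0//.
      by rewrite ltr_wpDl ?sqr_ge0 ?exprn_even_gt0.
    apply: sumr_ge0 => r _; rewrite mulrA divr_ge0 -?expr2 ?addr_ge0 ?sqr_ge0//.
  by rewrite -mulr_sumr -[X in b * X]opprK -sumrN -ImS oppr0 mulr0 ltxx.
rewrite leNgt; apply/negP => a0.
have : 0 < \sum_(r <- rs') - ((a - r) / ((a - r) ^+ 2 + b ^+ 2)).
  have H r : r \in rs' -> 0 < - ((a - r) / ((a - r) ^+ 2 + b ^+ 2)).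
    move=> /(allP rs0) r0'; rewrite -mulNr.
    have ar : a - r < 0 by rewrite subr_lt0 (lt_le_trans a0).
    by rewrite divr_gt0 ?oppr_gt0// ltr_pwDl ?sqr_ge0 ?exprn_even_gt0 //= lt_eqF.
  rewrite /rs' big_cons ltr_pwDl ?H ?mem_head//.
  rewrite big_seq; apply: sumr_ge0 => r rrs; rewrite ltW// H//.
  by rewrite inE rrs orbT.
by rewrite sumrN -ReS oppr0 ltxx.
Qed.

Lemma nonneg_split_mulXn (R : realType) (p : {poly R}) m :
  nonneg_split p -> nonneg_split ('X^m * p).
Proof.
move=> [c [rs [rs0 ->]]]; exists c, (nseq m 0 ++ rs); split.
  by rewrite all_cat rs0 andbT; apply/allP => r /nseqP[-> _].
rewrite big_cat /= -scalerAr; congr (_ *: (_ * _)).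
by rewrite big_nseq subr0 iter_mulr_1.
Qed.

Lemma nonneg_split_divXn (R : realType) (p q : {poly R}) m :
  p * 'X^m = q -> nonneg_split q -> nonneg_split p.
Proof.
move=> pq qs; have [->|p0] := eqVneq p 0.
  by exists 0, [::]; rewrite scale0r.
apply: nonneg_rooted_split => z pz.
have q0 : q != 0 by rewrite -pq mulf_neq0// expf_neq0// polyX_eq0.
by apply: (nonneg_split_rooted q0 qs); rewrite -pq rmorphM/= rootM pz.
Qed.

Lemma nonneg_splitZ (R : realType) (p : {poly R}) d :
  nonneg_split p -> nonneg_split (d *: p).
Proof.
by move=> [c [rs [rs0 ->]]]; exists (d * c), rs; split=> //; rewrite scalerA.
Qed.

Lemma nonneg_split_derivn (R : realType) (p : {poly R}) b :
  nonneg_split p -> nonneg_split p^`(b).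
Proof. by move=> ps; elim: b => // b IH; rewrite derivnS; exact: nonneg_split_deriv. Qed.

Lemma nonneg_split_iter (R : realType) (d : R) (a b l : nat) (p : {poly R}) :
  nonneg_split p ->
  nonneg_split (iter l (fun q => d *: ('X^a * q^`(b))) p).
Proof.
move=> ps; elim: l => // l IH; rewrite iterS.
by apply/nonneg_splitZ/nonneg_split_mulXn/nonneg_split_derivn.
Qed.

Lemma iter_unscaled (R : realType) (a b l : nat) (p : {poly R}) :
  iter l (fun q => 'X^a * q^`(b)) p = iter l (fun q => 1 *: ('X^a * q^`(b))) p.
Proof. by apply: eq_iter => q; rewrite scale1r. Qed.

Lemma nonneg_split_diff_iter (R : realType) (a b l : nat) (p : {poly R}) :
  nonneg_split p -> nonneg_split (diff_iter a b l p).
Proof.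
move=> ps; apply: nonneg_split_divXn (diff_iterE a b l p) _.
by rewrite iter_unscaled; apply/nonneg_split_mulXn/nonneg_split_iter.
Qed.

Lemma nonneg_split_T_poly (R : realType) (a b n l : nat) :
  nonneg_split (T_poly R a b n l).
Proof.
apply: nonneg_split_divXn (T_polyE R a b n l) _.
apply/nonneg_split_mulXn/nonneg_split_iter; exists 1, (nseq n 1); split.
  by apply/allP => r /nseqP[-> _].
by rewrite scale1r big_nseq iter_mulr_1.
Qed.

(** The factor by which [l] applications of z^a (d/dz)^b multiply z^k. In the
    truncated subtraction, a falling factorial of 0 occurs once the monomial
    has been killed (for b > 0). *)
Definition diff_mult (a b l k : nat) : nat :=
  (\prod_(j < l) (k + j * a - j * b) ^_ b)%N.

Lemma coef_iter_diff (R : realType) (d : R) (a b l : nat) (p : {poly R}) k :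
  ('X^(l * b) * iter l (fun q => d *: ('X^a * q^`(b))) p)`_(k + l * a) =
  d ^+ l * (diff_mult a b l k)%:R * p`_k.
Proof.
rewrite coefXnM; elim: l => [|l IH] in k *.
  by rewrite !mul0n addn0 subn0 ltn0 /diff_mult big_ord0 expr0 !mul1r.
rewrite /diff_mult big_ord_recr /= -/(diff_mult a b l k).
have [lt|ge] := ltnP.
  rewrite (_ : (_ ^_ b)%N = 0%N) ?muln0 ?mulr0 ?mul0r//.
  by apply/eqP; rewrite -leqn0 leqNgt ffact_gt0 -ltnNge; lia.
rewrite coefZ coefXnM; have [lt'|ge'] := ltnP.
  rewrite mulr0 (_ : (_ ^_ b)%N = 0%N) ?muln0 ?mulr0 ?mul0r//.
  by apply/eqP; rewrite -leqn0 leqNgt ffact_gt0 -ltnNge; lia.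
rewrite coef_derivn.
have := IH k; rewrite ltnNge (_ : (l * b <= k + l * a)%N) /=; last by lia.
rewrite (_ : (b + (k + l.+1 * a - l.+1 * b - a))%N = (k + l * a - l * b)%N); last by lia.
by move=> ->; rewrite natrM exprS -mulr_natl; ring.
Qed.

Lemma coef_diff_iter (R : realType) (a b l : nat) (p : {poly R}) k :
  (diff_iter a b l p)`_k = (diff_mult a b l k)%:R * p`_k.
Proof.
have := coef_iter_diff 1 a b l p k; rewrite -iter_unscaled -diff_iterE expr1n mul1r => <-.
by rewrite coefMXn ltnNge leq_addl addnK.
Qed.

Lemma coef_T_poly (R : realType) (a b n l k : nat) :
  (T_poly R a b n l)`_k =
  (n%:R ^- b) ^+ l * (diff_mult a b l k)%:R * (('X - 1) ^+ n : {poly R})`_k.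
Proof. by rewrite -coef_iter_diff -T_polyE coefMXn ltnNge leq_addl addnK. Qed.

Lemma diff_mult_gt0 (a b l k : nat) :
  (b <= k)%N -> (l * b + b <= k + l * a)%N -> (0 < diff_mult a b l k)%N.
Proof.
move=> bk H; apply: prodn_gt0 => j; rewrite ffact_gt0.
have jl := ltn_ord j; move: (nat_of_ord j) jl => {}j jl.
have [ab|ba] := leqP b a; nia.
Qed.

(** * The kernel x/(x+t) and lists of zeros *)

(** Constant on the negative half-line, so that it is continuous on the whole
    extended line; only the values at t >= 0 matter. *)
Definition kern (R : realType) (x : R) (t : \bar R) : R :=
  match t with r%:E => x / (x + Num.max r 0) | +oo%E => 0 | -oo%E => 1 end.

Lemma kern_ge0 (R : realType) (x : R) t : 0 < x -> 0 <= kern x t.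
Proof.
by move=> x0; case: t => [r| |] //=; rewrite divr_ge0 ?addr_ge0 ?le_max ?lexx ?orbT ?ltW.
Qed.

Lemma kern_le1 (R : realType) (x : R) t : 0 < x -> kern x t <= 1.
Proof.
move=> x0; case: t => [r| |] //=.
have r0 : 0 <= Num.max r 0 by rewrite le_max lexx orbT.
by rewrite ler_pdivrMr ?mul1r ?lerDl// ltr_pwDl.
Qed.

Lemma kern_in01 (R : realType) (x : R) ts : 0 < x -> in01 (map (kern x) ts).
Proof. by move=> x0; apply/allP => _ /mapP[t _ ->]; rewrite kern_ge0// kern_le1. Qed.

(** With w = 1/(1+t), the success probability of a Bernoulli variable of
    parameter w, reweighted by x, is x/(x+t). *)
Lemma kern_bern (R : realType) (x : R) t : 0 < x -> (0 <= t)%E ->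
  kern x t = kern 1 t * x / (1 - kern 1 t + kern 1 t * x).
Proof.
move=> x0; case: t => [r| |] //=; last by rewrite !mul0r.
rewrite lee_fin => r0; rewrite (max_idPl r0).
have d1 : 1 + r != 0 by rewrite lt0r_neq0// ltr_pwDl.
have d2 : x + r != 0 by rewrite lt0r_neq0// ltr_pwDl.
have -> : 1 - 1 / (1 + r) + 1 / (1 + r) * x = (x + r) / (1 + r) by field.
by field; rewrite d1.
Qed.

Lemma bern_mean_kern (R : realType) (x : R) ts :
  0 < x -> all (fun t => 0 <= t)%E ts ->
  bern_mean (map (kern 1) ts) x = \sum_(t <- ts) kern x t.
Proof.
move=> x0 /allP ts0; rewrite /bern_mean big_map big_seq [RHS]big_seq.
by apply: eq_bigr => t /ts0 t0; rewrite [RHS]kern_bern.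
Qed.

Lemma measurable_ereal_fun (R : realType) (f : \bar R -> R) :
  measurable_fun setT (f \o EFin) -> measurable_fun setT f.
Proof.
move=> mf _ B mB; rewrite setTI.
exists ((f \o EFin) @^-1` B); first by rewrite -[X in measurable X]setTI; exact: mf.
have [p|p] := pselect (B (f +oo%E)); have [m|m] := pselect (B (f -oo%E)).
- exists [set -oo; +oo]%E; first by constructor.
  by apply/seteqP; split=> [[r| |]|[r| |]] /=; do ?[by left; exists r | by right; left | by right; right | by move=> [[? ? []]|[]]] => //; move=> [[? ? [<-]]|[]].
- exists [set +oo]%E; first by constructor.
  apply/seteqP; split=> [[r| |]|[r| |]] //=.
  + by move=> [[? ? [<-]]|].
  + by move=> [[]|].
  + by left; exists r.
  + by right.
- exists [set -oo]%E; first by constructor.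
  apply/seteqP; split=> [[r| |]|[r| |]] //=.
  + by move=> [[? ? [<-]]|].
  + by move=> [[]|].
  + by left; exists r.
  + by right.
- exists set0; first by constructor.
  apply/seteqP; split=> [[r| |]|[r| |]] //=.
  + by move=> [[? ? [<-]]|].
  + by move=> [[]|].
  + by move=> [[]|].
  + by left; exists r.
Qed.

Lemma continuous_measurable_ereal (R : realType) (f : \bar R -> R) :
  continuous f -> measurable_fun setT f.
Proof.
move=> cf; apply: measurable_ereal_fun.
by apply: continuous_measurable_fun => x; apply: continuous_comp (cf _) => A.
Qed.

Lemma ge0_integral_zero_dist (R : realType) (n : nat) (p : {poly R}) (f : \bar R -> \bar R) :
  measurable_fun setT f -> (forall t, 0 <= f t)%E ->
  (\int[zero_dist n p]_t f t = (n%:R^-1)%:E *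
    (\sum_(x <- rootsR p) (mup x p)%:R%:E * f x%:E +
     (n - (size p).-1)%:R%:E * f +oo))%E.
Proof.
move=> mf f0; rewrite /zero_dist ge0_integral_mscale//=; congr (_ * _)%E.
rewrite ge0_integral_measure_add// ge0_integral_mscale//= integral_dirac//.
rewrite diracT mul1e; congr (_ + _)%E.
rewrite ge0_integral_measure_sum// (big_nth 0) big_mkord; apply: eq_bigr => i _.
by rewrite ge0_integral_mscale//= integral_dirac// diracT mul1e.
Qed.

(** Replacing X by -X turns X-r into -(1+r)(1-w+wX) with w = 1/(1+r). *)
Lemma coef_prod_XsubC_bern (R : realType) (rs : seq R) k :
  all (fun r => 0 <= r) rs ->
  (-1) ^+ k * (\prod_(r <- rs) ('X - r%:P))`_k =
  (-1) ^+ size rs * \prod_(r <- rs) (1 + r) *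
    (bern_poly (map (kern 1 \o EFin) rs))`_k.
Proof.
elim: rs k => [|r rs IH] k.
  by rewrite /bern_poly !big_nil coef1; case: k => [|k] /=; rewrite ?mulr0 ?mul1r.
move=> /= /andP[r0 rs0]; have {}IH k' := IH k' rs0.
have r1 : 1 + r != 0 by rewrite lt0r_neq0// ltr_pwDl.
rewrite !big_cons mulrBl coefB coefXM coefCM (max_idPl r0).
case: k => [|k] /=.
  rewrite coef_bern_cons0 sub0r expr0 mul1r.
  have := IH 0%N; rewrite expr0 mul1r => ->.
  by rewrite exprS; field.
set q := \prod_(j <- rs) ('X - j%:P) in IH *.
rewrite [LHS](_ : _ = - ((-1) ^+ k * q`_k) - r * ((-1) ^+ k.+1 * q`_k.+1)); last first.
  by rewrite exprS; ring.
by rewrite coef_bern_cons !IH exprS; field.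
Qed.

(** The missing n - deg p zeros sit at +oo, where w = 0 contributes the
    factor 1 to the generating polynomial. *)
Lemma zero_list (R : realType) (n : nat) (p : {poly R}) :
  (0 < n)%N -> p != 0 -> (size p <= n.+1)%N -> nonneg_split p ->
  exists ts : seq (\bar R),
    [/\ size ts = n, all (fun t => 0 <= t)%E ts,
        exists2 C : R, C != 0 &
          forall k, (-1) ^+ k * p`_k = C * (bern_poly (map (kern 1) ts))`_k &
        forall f : \bar R -> R, measurable_fun setT f ->
          \int[zero_dist n p]_t f t = (\sum_(t <- ts) f t) / n%:R].
Proof.
move=> n0 p0 sp [c [rs [rs0 pE]]].
have c0 : c != 0 by apply: contraNneq p0 => c0; rewrite pE c0 scale0r.
have szp : (size p).-1 = size rs by rewrite pE size_scale// size_prod_XsubC.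
have srs : (size rs <= n)%N by rewrite -szp; move: sp; case: (size p).
exists (map EFin rs ++ nseq (n - size rs) +oo%E); split.
- by rewrite size_cat size_map size_nseq subnKC.
- rewrite all_cat all_map (eq_all (a2 := fun r => 0 <= r))// rs0 /=.
  by apply/allP => t /nseqP[->].
- exists ((-1) ^+ size rs * c * \prod_(r <- rs) (1 + r)).
    rewrite !mulf_neq0 ?signr_eq0// prodf_seq_neq0; apply/allP => r /(allP rs0) r0.
    by rewrite lt0r_neq0// ltr_pwDl.
  move=> k; rewrite pE coefZ mulrCA (coef_prod_XsubC_bern k rs0).
  rewrite map_cat map_nseq -map_comp /bern_poly big_cat /= big_nseq subr0 scale0r addr0.
  by rewrite iter_mulr_1 expr1n mulr1 -/(bern_poly _); ring.
move=> f mf.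
have sum_rs (g : \bar R -> R) : \sum_(x <- rootsR p) (mup x p)%:R * g x%:E =
    \sum_(r <- rs) g r%:E.
  have mupE x : mup x p = count_mem x rs.
    by rewrite pE -mul_polyC mupMr ?mu_prod_XsubC// rootC.
  under eq_bigr do rewrite mupE.
  rewrite -[RHS]big_undup_iterop_count /=.
  rewrite (perm_big (undup rs)) /=.
    by apply: eq_bigr => r _; rewrite Monoid.iteropE iter_addr_0 mulr_natl.
  apply: uniq_perm; rewrite ?undup_uniq//.
    exact: (sorted_uniq lt_trans ltxx (sorted_roots _ _ _)).
  move=> r; rewrite mem_undup -roots_on_rootsR// in_itv /= pE rootZ//.
  by rewrite root_prod_XsubC.
have intg (g : \bar R -> R) : measurable_fun setT g -> (forall t, 0 <= g t) ->
    (\int[zero_dist n p]_t (g t)%:E)%E =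
    ((\sum_(r <- rs) g r%:E + (n - size rs)%:R * g +oo%E) / n%:R)%:E.
  move=> mg g0; rewrite ge0_integral_zero_dist//; last exact/measurable_EFinP.
  rewrite szp -sum_rs [in RHS]mulrC EFinM EFinD -sumEFin; congr (_ * (_ + _))%E.
rewrite big_cat big_map big_nseq iter_addr_0.
rewrite /Rintegral integralE.
have -> : (\int[zero_dist n p]_t ((fun t => (f t)%:E)^\+ t))%E =
    (\int[zero_dist n p]_t (f^\+ t)%:E)%E.
  by apply: eq_integral => t _; rewrite funeposE /funrpos EFin_max.
have -> : (\int[zero_dist n p]_t ((fun t => (f t)%:E)^\- t))%E =
    (\int[zero_dist n p]_t (f^\- t)%:E)%E.
  by apply: eq_integral => t _; rewrite funenegE /funrneg EFin_max EFinN.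
rewrite !intg; [|exact: measurable_funrneg|exact: funrneg_ge0
  |exact: measurable_funrpos|exact: funrpos_ge0].
rewrite -EFinB /= -mulrBl; congr (_ / _).
have fE t : f^\+ t - f^\- t = f t by rewrite -[in RHS](funrposBneg f).
rewrite opprD addrACA -sumrB -mulrBr fE mulr_natl.
by congr (_ + _); apply: eq_bigr => r _; rewrite fE.
Qed.

(** * Weak limits of point lists with convergent moments *)

Lemma bernoulli_ineq (R : realFieldType) (y : R) m :
  0 <= y -> 1 + m%:R * y <= (1 + y) ^+ m.
Proof.
move=> y0; elim: m => [|m IH]; first by rewrite mul0r addr0.
rewrite exprS -natr1.
have := ler_wpM2l (addr_ge0 ler01 y0) IH; apply: le_trans.
have my : 0 <= m%:R * y * y by rewrite !mulr_ge0.
lra.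
Qed.

Lemma bernoulli_ineqN (R : realFieldType) (y : R) m :
  0 <= y <= 1 -> 1 - m%:R * y <= (1 - y) ^+ m.
Proof.
move=> /andP[y0 y1]; elim: m => [|m IH]; first by rewrite mul0r subr0.
rewrite exprS -natr1; have y1' : 0 <= 1 - y by rewrite subr_ge0.
have := ler_wpM2l y1' IH; apply: le_trans.
have my : 0 <= m%:R * y * y by rewrite !mulr_ge0.
lra.
Qed.

(** The polynomial (1-p^m)^M with M about c^(-m), where a < c < b: by Bernoulli's
    inequality it is at least 1-M p^m, which is close to 1 for p <= a, and at
    most 1/(1+M p^m), which is close to 0 for p >= b. *)
Lemma step_poly (R : realType) (a b eps : R) : 0 < a -> a < b -> b <= 1 -> 0 < eps ->
  exists q : {poly R}, forall p, 0 <= p <= 1 ->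
    [/\ 0 <= q.[p] <= 1, p <= a -> 1 - eps <= q.[p] & b <= p -> q.[p] <= eps].
Proof.
move=> a0 ab b1 eps0; pose c := (a + b) / 2.
have ac : a < c by rewrite /c; lra.
have cb : c < b by rewrite /c; lra.
have c0 : 0 < c by exact: lt_trans ac.
have b0 : 0 < b by exact: lt_trans cb.
have small (z d : R) : 0 <= z < 1 -> 0 < d -> \forall m \near \oo, z ^+ m <= d.
  move=> /andP[z0 z1] d0; have : (fun m => z ^+ m : R) @ \oo --> (0 : R).
    by apply: cvg_expr; rewrite ger0_norm.
  move=> /cvgr0Pnorm_le/(_ _ d0); apply: filterS => m.
  by rewrite normrX (ger0_norm z0).
have e2 : 0 < eps / 2 by rewrite divr_gt0.
have [m [m1 m2 m3]] : exists m, [/\ (a / c) ^+ m <= eps / 2, a ^+ m <= eps / 2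
    & (c / b) ^+ m <= eps].
  have ac1 : 0 <= a / c < 1 by rewrite divr_ge0 ?ltW//= ltr_pdivrMr ?mul1r.
  have a1 : 0 <= a < 1 by rewrite ltW//= (lt_le_trans ab).
  have cb1 : 0 <= c / b < 1 by rewrite divr_ge0 ?ltW//= ltr_pdivrMr ?mul1r.
  have H1 := small _ _ ac1 e2; have H2 := small _ _ a1 e2; have H3 := small _ _ cb1 eps0.
  near \oo => m; exists m; split; near: m; [exact: H1|exact: H2|exact: H3].
pose M := (Num.truncn (c ^- m)).+1.
have cm0 : 0 < c ^+ m by rewrite exprn_gt0.
have /andP[Mlo Mhi] : c ^- m <= M%:R <= c ^- m + 1.
  have icm0 : 0 <= c ^- m by rewrite invr_ge0 ltW.
  have /andP[h1 h2] := truncn_itv icm0.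
  by rewrite (ltW h2) /M -natr1 lerD2r.
exists ((1 - 'X^m) ^+ M) => p /andP[p0 p1].
rewrite horner_exp hornerD hornerN hornerC hornerXn.
have pm0 : 0 <= p ^+ m by rewrite exprn_ge0.
have pm1 : p ^+ m <= 1 by rewrite exprn_ile1.
have qm0 : 0 <= 1 - p ^+ m by rewrite subr_ge0.
split.
- by rewrite exprn_ge0//= exprn_ile1// lerBlDr lerDl.
- move=> pa; apply: le_trans (bernoulli_ineqN M (_ : 0 <= p ^+ m <= 1)); last by rewrite pm0.
  rewrite lerD2l lerN2; have pam : p ^+ m <= a ^+ m by rewrite lerXn2r// nnegrE ltW.
  apply: (@le_trans _ _ ((c ^- m + 1) * a ^+ m)).
    by rewrite ler_pM// ?ler0n.
  rewrite mulrDl mul1r -exprVn -exprMn mulrC; lra.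
- move=> bp; have bpm : b ^+ m <= p ^+ m by rewrite lerXn2r// nnegrE ltW.
  have Mp : eps^-1 <= M%:R * p ^+ m.
    apply: (@le_trans _ _ (c ^- m * b ^+ m)).
      have cbm0 : 0 < (c / b) ^+ m by rewrite exprn_gt0// divr_gt0.
      rewrite -exprVn -exprMn -[X in _ <= X ^+ _]invrK invfM invrK exprVn.
      by rewrite lef_pV2 ?posrE.
    by rewrite ler_pM// ?invr_ge0 ?exprn_ge0// ltW.
  have h : (1 - p ^+ m) ^+ M * (1 + p ^+ m) ^+ M <= 1.
    rewrite -exprMn exprn_ile1//; nra.
  have h2 := bernoulli_ineq M pm0.
  have h3 : eps^-1 <= (1 + p ^+ m) ^+ M by lra.
  have ie0 : 0 < eps^-1 by rewrite invr_gt0.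
  rewrite -(ler_pM2r ie0) mulfV ?gt_eqF//.
  by apply: le_trans h; rewrite ler_wpM2l// exprn_ge0.
Unshelve. all: by end_near. Qed.

Definition cell (R : realType) (n i : nat) : set R :=
  `[i%:R / n%:R, i.+1%:R / n%:R[.

(** Defined by a sum of indicators, so that measurability and integrals are
    immediate; for 0 <= u < 1 it is the usual quantile function, by [quantileE]. *)
Definition quantile (R : realType) (s : seq R) (u : R) : R :=
  \sum_(i < size s) nth 0 (sort <=%R s) i * \1_(@cell R (size s) i) u.

Lemma cell_truncn (R : realType) (n i : nat) (u : R) : (0 < n)%N -> 0 <= u ->
  @cell R n i u <-> i = Num.truncn (u * n%:R).
Proof.
move=> n0 u0; have n0' : 0 < n%:R :> R by rewrite ltr0n.
have un0 : 0 <= u * n%:R by rewrite mulr_ge0// ltW.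
rewrite /cell /= in_itv /= ler_pdivrMr// ltr_pdivlMr//.
have h := truncn_itv un0.
split=> [hi|->//]; apply/esym/eqP; rewrite truncn_eq//.
Qed.

Lemma sum_cell (R : realType) (n : nat) (u : R) (F : nat -> R) :
  (0 < n)%N -> 0 <= u < 1 ->
  \sum_(i < n) F i * \1_(@cell R n i) u = F (Num.truncn (u * n%:R)) /\
  (Num.truncn (u * n%:R) < n)%N.
Proof.
move=> n0 /andP[u0 u1]; have n0' : 0 < n%:R :> R by rewrite ltr0n.
have un0 : 0 <= u * n%:R by rewrite mulr_ge0// ltW.
have jn : (Num.truncn (u * n%:R) < n)%N.
  have /andP[h _] := truncn_itv un0; rewrite -(ltr_nat R); apply: le_lt_trans h _.
  by rewrite -[X in _ < X]mul1r ltr_pM2r.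
split=> //; rewrite (bigD1 (Ordinal jn))//= big1 ?addr0.
  by rewrite indicE mem_set ?mulr1//; exact/cell_truncn.
move=> i ij; rewrite indicE memNset ?mulr0// => /(cell_truncn _ n0 u0) iE.
by move/eqP: ij; apply; apply: val_inj.
Qed.

Lemma quantileE (R : realType) (s : seq R) (u : R) :
  (0 < size s)%N -> 0 <= u < 1 ->
  quantile s u = nth 0 (sort <=%R s) (Num.truncn (u * (size s)%:R)).
Proof. by move=> s0 u01; have [] := sum_cell (nth 0 (sort <=%R s)) s0 u01. Qed.

Lemma nth_sort_le (R : realType) (s : seq R) i j :
  (i <= j)%N -> (j < size s)%N ->
  nth 0 (sort <=%R s) i <= nth 0 (sort <=%R s) j.
Proof.
move=> ij js; apply: (sorted_leq_nth (@le_trans _ R) (@lexx _ R)) => //.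
- exact: (sort_sorted (@le_total _ R)).
- by rewrite inE size_sort (leq_ltn_trans ij).
- by rewrite inE size_sort.
Qed.

Lemma nth_sort_in01 (R : realType) (s : seq R) i :
  in01 s -> (i < size s)%N -> 0 <= nth 0 (sort <=%R s) i <= 1.
Proof. by move=> /allP s01 si; apply: s01; rewrite -(mem_sort <=%R) mem_nth ?size_sort. Qed.

Lemma quantile_in01 (R : realType) (s : seq R) (u : R) :
  in01 s -> 0 <= u < 1 -> 0 <= quantile s u <= 1.
Proof.
move=> s01 u01; have [s0|s0] := posnP (size s).
  by rewrite /quantile s0 big_ord0 lexx ler01.
rewrite quantileE//; apply: nth_sort_in01 => //.
by have [] := sum_cell (fun=> 0) s0 u01.
Qed.

Lemma sum_sort (R : realType) (s : seq R) (F : R -> R) :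
  \sum_(p <- s) F p = \sum_(i < size s) F (nth 0 (sort <=%R s) i).
Proof.
rewrite -(perm_big _ (permEl (perm_sort <=%R s))) /= (big_nth 0) big_mkord.
by rewrite size_sort.
Qed.

Lemma quantile_lt_sum (R : realType) (s : seq R) (q : R -> R) (u a eps : R) :
  in01 s -> 0 <= u < 1 -> 0 <= eps <= 1 -> (0 < size s)%N ->
  (forall p, 0 <= p <= 1 -> 0 <= q p) ->
  (forall p, 0 <= p <= 1 -> p <= a -> 1 - eps <= q p) ->
  quantile s u < a -> u * (1 - eps) <= (\sum_(p <- s) q p) / (size s)%:R.
Proof.
move=> s01 u01 /andP[e0 e1] s0 q0 qa; rewrite quantileE// sum_sort.
set n := size s in s0 *; set j := Num.truncn _ => sja.
have n0 : 0 < n%:R :> R by rewrite ltr0n.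
have [_ jn] := sum_cell (fun=> 0) s0 u01.
rewrite ler_pdivlMr// mulrAC.
apply: (@le_trans _ _ (j.+1%:R * (1 - eps))).
  rewrite ler_wpM2r ?subr_ge0//; case/andP: u01 => u0 u1.
  have un0 : 0 <= u * n%:R by rewrite mulr_ge0// ltW.
  by have /andP[_ /ltW] := truncn_itv un0.
rewrite -/j in jn; rewrite -(subnKC jn) big_split_ord /=.
apply: ler_wpDr.
  by apply: sumr_ge0 => i _; apply/q0/nth_sort_in01 => //; rewrite -/n; have := ltn_ord i; lia.
rewrite mulr_natl -[X in _ *+ X]card_ord -sumr_const; apply: ler_sum => i _.
have ij : (i <= j)%N by rewrite -ltnS.
apply: qa; first by apply: nth_sort_in01 => //; exact: leq_ltn_trans jn.
by apply/ltW; apply: le_lt_trans sja; exact: nth_sort_le.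
Qed.

Lemma quantile_gt_sum (R : realType) (s : seq R) (q : R -> R) (u b eps : R) :
  in01 s -> 0 <= u < 1 -> 0 <= eps -> (0 < size s)%N ->
  (forall p, 0 <= p <= 1 -> q p <= 1) ->
  (forall p, 0 <= p <= 1 -> b <= p -> q p <= eps) ->
  b < quantile s u -> (\sum_(p <- s) q p) / (size s)%:R <= u + eps.
Proof.
move=> s01 u01 e0 s0 q1 qb; rewrite quantileE// sum_sort.
set n := size s in s0 *; set j := Num.truncn _ => sjb.
have n0 : 0 < n%:R :> R by rewrite ltr0n.
have [_ jn] := sum_cell (fun=> 0) s0 u01.
rewrite ler_pdivrMr// mulrDl.
apply: (@le_trans _ _ (j%:R + eps * n%:R)); last first.
  rewrite lerD2r; case/andP: u01 => u0 u1.
  have un0 : 0 <= u * n%:R by rewrite mulr_ge0// ltW.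
  by have /andP[] := truncn_itv un0.
rewrite -/j in jn; rewrite -(subnKC (ltnW jn)) big_split_ord /=; apply: lerD.
  rewrite -[X in _ <= X%:R]card_ord -sumr_const; apply: ler_sum => i _.
  by apply/q1/nth_sort_in01 => //; exact: ltn_trans jn.
apply: (@le_trans _ _ (\sum_(i < n - j) eps)).
  apply: ler_sum => i _; have h : (j + i < n)%N by have := ltn_ord i; lia.
  apply: qb; first exact: nth_sort_in01.
  by apply/ltW; apply: lt_le_trans sjb _; apply: nth_sort_le => //; rewrite leq_addr.
by rewrite sumr_const card_ord -[leLHS]mulr_natr ler_wpM2l// ler_nat; lia.
Qed.

(** A bounded sequence that does not oscillate across any rational gap
    converges. *)
Lemma osc_cvg_limn_sup (R : realType) (u : nat -> R) :
  (forall n, 0 <= u n <= 1) ->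
  (forall a b : rat, a < b ->
     (\forall n \near \oo, ratr a <= u n) \/ (\forall n \near \oo, u n <= ratr b)) ->
  u @ \oo --> limn_sup u.
Proof.
move=> u01 osc.
have bu : bounded_fun u.
  by exists 1; split; [exact: num_real|] => x x1 n _ /=; have /andP[h0 h1] := u01 n;
    rewrite ger0_norm// (le_trans h1)// ltW.
have ubu : has_ubound (range u).
  by exists 1 => _ [n _ <-]; have /andP[] := u01 n.
have us n k : (n <= k)%N -> u k <= sups u n.
  move=> nk; apply: ub_le_sup; last by exists k.
  by exists 1 => _ [j _ <-]; have /andP[] := u01 j.
have lbs : has_lbound (range (sups u)).
  by exists 0 => _ [n _ <-]; apply: le_trans (us n n (leqnn n)); have /andP[] := u01 n.
set L := limn_sup u; have LE : L = inf (range (sups u)) := limn_supE bu.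
have Ls n : L <= sups u n by rewrite LE; apply: ge_inf => //; exists n.
apply/cvgrPdist_le => e e0.
have e3 : 0 < e / 3 by rewrite divr_gt0.
have [_ [N _ <-] sN] : exists2 y, range (sups u) y & y < L + e / 3.
  by rewrite LE; apply: inf_adherent => //; split=> //; exists (sups u 0%N), 0%N.
have [a /andP[a1 a2]] : exists a : rat, L - e < ratr a < L - 2 * (e / 3).
  have [|q /itvP h] := @rat_in_itvoo R (L - e) (L - 2 * (e / 3)); first by lra.
  by exists q; rewrite !h.
have [b /andP[b1 b2]] : exists b : rat, L - 2 * (e / 3) < ratr b < L - e / 3.
  have [|q /itvP h] := @rat_in_itvoo R (L - 2 * (e / 3)) (L - e / 3); first by lra.
  by exists q; rewrite !h.
have ab : a < b by rewrite -(ltr_rat R); exact: lt_trans a2 b1.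
have [ha|[M _ hb]] := osc a b ab.
  near=> n; have un : ratr a <= u n by near: n.
  have un2 : u n <= sups u N by apply: us; near: n; exact: nbhs_infty_ge.
  rewrite ler_norml; lra.
exfalso; have : sups u M <= ratr b.
  apply: ge_sup; first by exists (u M); exists M => /=.
  by move=> _ [k /= Mk <-]; exact: hb.
have := Ls M; lra.
Unshelve. all: by end_near. Qed.

Lemma moments_horner_cvg (R : realType) (ps : nat -> seq R) (q : {poly R}) :
  (forall k, cvgn (fun n => (\sum_(p <- ps n) p ^+ k) / n%:R)) ->
  cvgn (fun n => (\sum_(p <- ps n) q.[p]) / n%:R).
Proof.
move=> mom; rewrite [X in cvgn X](_ : _ = fun n =>
    \sum_(i < size q) q`_i * ((\sum_(p <- ps n) p ^+ i) / n%:R)); last first.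
  apply/funext => n; under [in LHS]eq_bigr do rewrite horner_coef.
  rewrite exchange_big /= mulr_suml; apply: eq_bigr => i _.
  by rewrite mulrA mulr_sumr.
elim: (size q) => [|m IH].
  rewrite [X in cvgn X](_ : _ = cst 0); first exact: is_cvg_cst.
  by apply/funext => n; rewrite big_ord0.
under eq_fun do rewrite big_ord_recr /=.
by apply: is_cvgD => //; apply: is_cvgM; [exact: is_cvg_cst|exact: mom].
Qed.

(** If the quantiles at u oscillate across the gap [a,b], then a fraction u of
    the points lies below a for infinitely many n, and a fraction 1-u lies
    above b for infinitely many n. Hence the limiting average of a polynomial
    close to the indicator of [0,a] determines u: at most one u oscillates. *)
Lemma quantile_osc_unique (R : realType) (ps : nat -> seq R) (a b u v : R) :
  (forall n, size (ps n) = n) -> (forall n, in01 (ps n)) ->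
  (forall k, cvgn (fun n => (\sum_(p <- ps n) p ^+ k) / n%:R)) ->
  a < b -> 0 <= u < 1 -> 0 <= v < 1 -> u < v ->
  ~ (\forall n \near \oo, quantile (ps n) u <= b) ->
  ~ (\forall n \near \oo, a <= quantile (ps n) v) -> False.
Proof.
move=> szp p01 mom ab u01 v01 uv nb na.
have io (P : nat -> Prop) N : ~ (\forall n \near \oo, P n) ->
    exists2 n, (N <= n)%N & ~ P n.
  move=> nP; apply: contrapT => h; apply: nP; exists N => // n /= Nn.
  by apply: contrapT => nPn; apply: h; exists n.
have a0 : 0 < a.
  have [n _ /negP] := io _ 0%N na; rewrite -ltNge => h.
  by have /andP[h0 _] := quantile_in01 (p01 n) v01; exact: le_lt_trans h0 h.
have b1 : b <= 1.
  have [n _ /negP] := io _ 0%N nb; rewrite -ltNge => h.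
  by have /andP[_ h0] := quantile_in01 (p01 n) u01; apply/ltW; exact: lt_le_trans h h0.
pose eps := (v - u) / 4.
have [u0 u1] := andP u01; have [v0 v1] := andP v01.
have e0 : 0 < eps by rewrite /eps; lra.
have e1 : eps <= 1 by rewrite /eps; lra.
(* eps = (v-u)/4 makes v (1-eps) <= limn A <= u + eps impossible *)
have [q hq] := step_poly a0 ab b1 e0.
pose A n := (\sum_(p <- ps n) q.[p]) / n%:R.
have cA : cvgn A by exact: (@moments_horner_cvg _ ps q mom).
have hv : v * (1 - eps) <= limn A.
  rewrite leNgt; apply/negP => h; apply: na.
  have := cvgr_lt (limn A) cA _ h => -[N _ hN].
  exists N.+1 => // n /= Nn; rewrite leNgt; apply/negP => lt.
  have := hN n (ltnW Nn); apply/negP; rewrite -leNgt /A.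
  rewrite -[X in _ / X%:R]szp; apply: quantile_lt_sum lt => //.
  + by rewrite e1 ltW.
  + by rewrite szp; exact: leq_ltn_trans Nn.
  + by move=> p /hq[/andP[]].
  + by move=> p /hq[].
have hu : limn A <= u + eps.
  rewrite leNgt; apply/negP => h; apply: nb.
  have := cvgr_gt (limn A) cA _ h => -[N _ hN].
  exists N.+1 => // n /= Nn; rewrite leNgt; apply/negP => gt.
  have := hN n (ltnW Nn); apply/negP; rewrite -leNgt /A.
  rewrite -[X in _ / X%:R]szp; apply: quantile_gt_sum gt => //.
  + by rewrite ltW.
  + by rewrite szp; exact: leq_ltn_trans Nn.
  + by move=> p /hq[/andP[]].
  + by move=> p /hq[].
have := le_trans hv hu; rewrite /eps => {}h.
have : v * ((v - u) / 4) <= (v - u) / 4 by rewrite ler_piMl// ltW.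
by move: h; rewrite mulrBr mulr1; lra.
Qed.

(** Each rational gap rules out at most one point. *)
Lemma quantile_cvg_countable (R : realType) (ps : nat -> seq R) :
  (forall n, size (ps n) = n) -> (forall n, in01 (ps n)) ->
  (forall k, cvgn (fun n => (\sum_(p <- ps n) p ^+ k) / n%:R)) ->
  countable [set u : R | 0 <= u < 1 /\
    ~ (quantile (ps n) u @[n --> \oo] --> limn_sup (fun n => quantile (ps n) u))].
Proof.
move=> szp p01 mom.
pose B (ab : rat * rat) := [set u : R | [/\ 0 <= u < 1, ab.1 < ab.2,
  ~ (\forall n \near \oo, quantile (ps n) u <= ratr ab.2) &
  ~ (\forall n \near \oo, ratr ab.1 <= quantile (ps n) u)]].
apply: (@sub_countable _ _ _ (\bigcup_(ab in [set: rat * rat]) B ab)).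
  apply: subset_card_le => u [u01 nc].
  apply: contrapT => nB; apply: nc; apply: osc_cvg_limn_sup => [n|a b ab].
    exact: quantile_in01.
  have [?|na] := pselect (\forall n \near \oo, ratr a <= quantile (ps n) u); first by left.
  have [?|nb] := pselect (\forall n \near \oo, quantile (ps n) u <= ratr b); first by right.
  by exfalso; apply: nB; exists (a, b).
apply: bigcup_countable => // -[a b] _.
have [->|/set0P[u Bu]] := eqVneq (B (a, b)) set0; first exact: countable0.
apply: (@sub_countable _ _ _ [set u]); last exact: countable1.
apply: subset_card_le => v Bv /=; have [u01 ab nbu nau] := Bu; have [v01 _ nbv nav] := Bv.
have rab : ratr a < ratr b :> R by rewrite ltr_rat.
have [uv|vu|//] := ltgtP u v; exfalso.
  exact: (quantile_osc_unique szp p01 mom rab u01 v01 uv nbu nav).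
exact: (quantile_osc_unique szp p01 mom rab v01 u01 vu nbv nau).
Qed.

Lemma probability_integrable_bounded d (T : measurableType d) (R : realType)
    (P : probability T R) (f : T -> R) (M : R) :
  measurable_fun setT f -> (forall u, `|f u| <= M) ->
  P.-integrable setT (EFin \o f).
Proof.
move=> mf fM; apply: measurable_bounded_integrable => //.
  by apply: (@le_lt_trans _ _ 1%E); [exact: probability_le1|exact: ltry].
exists M; split; first exact: num_real.
by move=> x Mx u _ /=; apply: le_trans (fM u) (ltW Mx).
Qed.

Lemma bounded_convergence d (T : measurableType d) (R : realType)
    (P : probability T R) (f_ : nat -> T -> R) (f : T -> R) (M : R) :
  (forall n, measurable_fun setT (f_ n)) -> measurable_fun setT f ->
  (forall n u, `|f_ n u| <= M) ->
  {ae P, forall u, f_ n u @[n --> \oo] --> f u} ->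
  \int[P]_u f_ n u @[n --> \oo] --> \int[P]_u f u.
Proof.
move=> mf_ mf f_M f_f.
have [] := @dominated_convergence _ _ _ P setT measurableT
  (fun n u => (f_ n u)%:E) (fun u => (f u)%:E) (fun=> M%:E).
- by move=> n; exact/measurable_EFinP.
- exact/measurable_EFinP.
- by apply: filterS f_f => u fu _; apply: cvg_EFin => //; exact: nearW.
- exact: (@probability_integrable_bounded _ _ _ _ (fun=> M) `|M|).
- by apply: aeW => u n _; rewrite lee_fin.
move=> intf _ cI; apply: fine_cvg.
by rewrite fineK; [exact: cI|exact: integrable_fin_num].
Qed.

Lemma uniform_prob01E (R : realType) (A : set R) : measurable A ->
  uniform_prob (@ltr01 R) A = lebesgue_measure (A `&` `[0, 1]).
Proof.
move=> mA; transitivity (\int[uniform_prob (@ltr01 R)]_x (\1_A x)%:E)%E.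
  by rewrite integral_indic// setIT.
rewrite integral_uniform//; last exact/measurable_EFinP/measurable_indic.
by rewrite subr0 invr1 mul1e integral_indic.
Qed.

Lemma uniform_prob01_cell (R : realType) n i : (i < n)%N ->
  uniform_prob (@ltr01 R) (cell n i) = (n%:R^-1)%:E.
Proof.
move=> ltin; have n0 : 0 < n%:R :> R by rewrite ltr0n (leq_ltn_trans _ ltin).
rewrite uniform_prob01E; last exact: measurable_itv.
rewrite (_ : _ `&` _ = cell n i).
  rewrite /cell lebesgue_measure_itv/= lte_fin ltr_pM2r ?invr_gt0// ltr_nat ltnSn.
  by rewrite -EFinD -mulrBl -natr1 addrAC subrr add0r mul1r.
apply/seteqP; split=> [u []//|u iu]; split=> //; move: iu.
rewrite /cell /= !in_itv /= => /andP[h1 /ltW h2]; apply/andP; split.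
  by apply: le_trans h1; rewrite divr_ge0// ltW.
by apply: (le_trans h2); rewrite ler_pdivrMr// mul1r ler_nat.
Qed.

Lemma uniform_prob01_out (R : realType) :
  uniform_prob (@ltr01 R) (~` [set u | 0 <= u < 1]) = 0%E.
Proof.
have -> : [set u : R | 0 <= u < 1] = cell 1 0.
  by apply/funext => u; rewrite /cell /= in_itv /= !divr1.
rewrite probability_setC; last exact: measurable_itv.
rewrite [X in (_ - X)%E](_ : _ = 1%E) ?subee//.
by apply: etrans (@uniform_prob01_cell R 1 0 isT) _; rewrite invr1.
Qed.

Lemma uniform_prob01_ae (R : realType) (C : set R) (Q : R -> Prop) :
  countable C -> (forall u, 0 <= u < 1 -> ~ C u -> Q u) ->
  \forall u \ae uniform_prob (@ltr01 R), Q u.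
Proof.
move=> cC CQ; exists (C `|` ~` [set u | 0 <= u < 1]); split.
- apply: measurableU; first exact: countable_measurable.
  apply: measurableC; rewrite (_ : mkset _ = cell 1 0); first exact: measurable_itv.
  by apply/funext => u; rewrite /cell /= in_itv /= !divr1.
- have mD : measurable (~` [set u : R | 0 <= u < 1]).
    apply: measurableC; rewrite (_ : mkset _ = cell 1 0); first exact: measurable_itv.
    by apply/funext => u; rewrite /cell /= in_itv /= !divr1.
  have mC : measurable C by exact: countable_measurable.
  apply/eqP; rewrite eq_le measure_ge0 andbT.
  apply: (le_trans (measureU2 (uniform_prob (@ltr01 R)) mC mD)).
  rewrite [X in (_ + X)%E]uniform_prob01_out adde0 [leLHS](uniform_prob01E mC).
  rewrite (_ : lebesgue_measure _ = 0%E)//; apply: countable_lebesgue_measure0.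
  exact: sub_countable (subset_card_le (@subIsetl _ C _)) cC.
- move=> u nQ; apply: contrapT => /not_orP[nC /contrapT u01]; apply: nQ; exact: CQ.
Qed.

Lemma measurable_quantile (R : realType) (s : seq R) :
  measurable_fun setT (quantile s).
Proof.
apply: measurable_sum => i; apply: measurable_funM => //.
by apply: measurable_indic; exact: measurable_itv.
Qed.

Lemma quantile_in01T (R : realType) (s : seq R) (u : R) :
  in01 s -> 0 <= quantile s u <= 1.
Proof.
move=> s01; have [u01|u01] := boolP (0 <= u < 1); first exact: quantile_in01.
rewrite /quantile big1 ?lexx ?ler01// => i _; rewrite indicE memNset ?mulr0//.
rewrite /cell /= in_itv /= => /andP[h1 h2]; move/negP: u01; apply.
have n0 : 0 < (size s)%:R :> R by rewrite ltr0n (leq_ltn_trans _ (ltn_ord i)).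
apply/andP; split; first by apply: le_trans h1; rewrite divr_ge0.
by apply: (lt_le_trans h2); rewrite ler_pdivrMr// mul1r ler_nat.
Qed.

Lemma limn_sup_in01 (R : realType) (u : nat -> R) :
  (forall n, 0 <= u n <= 1) -> 0 <= limn_sup u <= 1.
Proof.
move=> u01.
have bu : bounded_fun u.
  by exists 1; split; [exact: num_real|] => x x1 n _ /=; have /andP[h0 h1] := u01 n;
    rewrite ger0_norm// (le_trans h1)// ltW.
have hs n : 0 <= sups u n <= 1.
  have un : sdrop u n (u n) by exists n => /=.
  apply/andP; split.
    have /andP[h _] := u01 n; apply: le_trans h _; apply: ub_le_sup => //.
    by exists 1 => _ [j _ <-]; have /andP[] := u01 j.
  by apply: ge_sup; [exists (u n)|move=> _ [j _ <-]; have /andP[] := u01 j].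
rewrite (limn_supE bu); apply/andP; split.
  by apply: lb_le_inf; [exists (sups u 0%N), 0%N|move=> _ [n _ <-]; have /andP[] := hs n].
have /andP[_ h] := hs 0%N; apply: le_trans h; apply: ge_inf; last by exists 0%N.
by exists 0 => _ [n _ <-]; have /andP[] := hs n.
Qed.

Lemma Rintegral_quantile (R : realType) (s : seq R) (F : R -> R) :
  measurable_fun setT F -> (0 < size s)%N ->
  \int[uniform_prob (@ltr01 R)]_u F (quantile s u) = (\sum_(p <- s) F p) / (size s)%:R.
Proof.
move=> mF s0; rewrite sum_sort /Rintegral.
have mq := measurable_quantile s.
pose h (i : 'I_(size s)) := fun u : R => (F (nth 0 (sort <=%R s) i) * \1_(cell (size s) i) u)%:E.
have mh i : measurable_fun setT (h i).
  apply/measurable_EFinP; apply: measurable_funM => //; apply: measurable_indic.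
  exact: measurable_itv.
transitivity (fine (\int[uniform_prob (@ltr01 R)]_u (\sum_(i < size s) h i u)))%E.
  congr fine; apply: ae_eq_integral => //.
  - by apply/measurable_EFinP; exact: measurableT_comp.
  - exact: emeasurable_sum.
  apply: (@uniform_prob01_ae _ set0); first exact: countable0.
  move=> u u01 _ _; rewrite /h sumEFin; congr (_%:E).
  have [-> _] := sum_cell (F \o nth 0 (sort <=%R s)) s0 u01.
  by rewrite quantileE.
rewrite integral_sum//; last first.
  move=> i; apply: (@probability_integrable_bounded _ _ _ _ _ `|F (nth 0 (sort <=%R s) i)|).
    by apply/measurable_EFinP; exact: mh.
  move=> u; rewrite normrM ler_piMr// indicE; case: (_ \in _); rewrite ?normr1 ?normr0//.
rewrite mulr_suml; under eq_bigr => i _.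
  rewrite /h; under eq_integral do rewrite EFinM.
  rewrite integralZl//; last first.
    apply: (@probability_integrable_bounded _ _ _ _ _ 1).
      by apply: measurable_indic; exact: measurable_itv.
    by move=> u; rewrite indicE; case: (_ \in _); rewrite ?normr1 ?normr0.
  rewrite integral_indic//; last exact: measurable_itv.
  rewrite setIT [X in (_ * X)%E](@uniform_prob01_cell R _ i (ltn_ord i)) -EFinM.
  over.
by rewrite /= sumEFin.
Qed.

(** A Helly-type theorem on [0,1]; the limit law is represented by a function
    of a uniform variable, as in Skorokhod's construction, so that dominated
    convergence applies. *)
Lemma moment_limit (R : realType) (ps : nat -> seq R) :
  (forall n, size (ps n) = n) -> (forall n, in01 (ps n)) ->
  (forall k, cvgn (fun n => (\sum_(p <- ps n) p ^+ k) / n%:R)) ->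
  exists g : R -> R, [/\ measurable_fun setT g, forall u, 0 <= g u <= 1 &
    forall F : R -> R, continuous F ->
      (\sum_(p <- ps n) F p) / n%:R @[n --> \oo] -->
      \int[uniform_prob (@ltr01 R)]_u F (g u)].
Proof.
move=> szp p01 mom; set P := uniform_prob (@ltr01 R).
pose g u := limn_sup (fun n => quantile (ps n) u).
have g01 u : 0 <= g u <= 1.
  by apply: limn_sup_in01 => n; exact: quantile_in01T.
have mg : measurable_fun setT g.
  apply: measurable_fun_limn_sup => [u _|u _|n]; last exact: measurable_quantile.
    by exists 1 => _ [n _ <-]; have /andP[] := quantile_in01T u (p01 n).
  by exists 0 => _ [n _ <-]; have /andP[] := quantile_in01T u (p01 n).
exists g; split=> // F cF.
have mF : measurable_fun setT F by exact: continuous_measurable_fun.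
have [M FM] : exists M : R, forall p : R, 0 <= p <= 1 -> `|F p| <= M.
  have /compact_bounded[M [_ hM]] : compact (F @` `[0, 1]%classic).
    apply: continuous_compact; last exact: segment_compact.
    by apply: continuous_subspaceT.
  exists (M + 1) => p p01'; apply: (hM (M + 1)); first by rewrite ltrDl.
  by exists p => //=; rewrite in_itv.
have cI : \int[P]_u F (quantile (ps n) u) @[n --> \oo] --> \int[P]_u F (g u).
  apply: (@bounded_convergence _ _ _ _ _ _ M).
  - by move=> n; apply: measurableT_comp => //; exact: measurable_quantile.
  - exact: measurableT_comp.
  - by move=> n u; apply: FM; exact: quantile_in01T.
  apply: uniform_prob01_ae (quantile_cvg_countable szp p01 mom) _ => u u01 nC.
  have cq : quantile (ps n) u @[n --> \oo] --> g u.
    by apply: contrapT => h; apply: nC.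
  exact: continuous_cvg (cF _) cq.
apply: cvg_trans cI; apply: near_eq_cvg; near=> n.
have n0 : (0 < size (ps n))%N by rewrite szp; near: n; exact: nbhs_infty_gt.
by rewrite -[X in _ / X%:R]szp -Rintegral_quantile.
Unshelve. all: by end_near. Qed.

(** * Kernel means of a law and its S-transform *)

(** The Lipschitz bound is relative to x, hence passes to all averages of
    the kernel uniformly. *)
Lemma kern_lip (R : realType) (x y : R) t : 0 < x -> x <= y ->
  kern x t <= kern y t <= kern x t + (y - x) / x.
Proof.
move=> x0 xy; have y0 := lt_le_trans x0 xy.
have d0 : 0 <= (y - x) / x by rewrite divr_ge0 ?subr_ge0// ltW.
case: t => [r| |] /=; rewrite ?lexx ?lerDl ?d0//.
set m := Num.max r 0; have m0 : 0 <= m by rewrite le_max lexx orbT.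
have xm : 0 < x + m by rewrite ltr_pwDl.
have ym : 0 < y + m by rewrite ltr_pwDl.
have -> : y / (y + m) = x / (x + m) + (y - x) / x * (x / (x + m) * (m / (y + m))).
  by field; rewrite !gt_eqF.
rewrite lerDl lerD2l; apply/andP; split.
  by rewrite !mulr_ge0 ?invr_ge0 ?subr_ge0// ltW.
rewrite ler_piMr// mulr_ile1 ?divr_ge0 ?ler_pdivrMr ?mul1r ?lerDl ?lerDr//; exact: ltW.
Qed.

Lemma kern_continuous (R : realType) (x : R) : 0 < x -> continuous (kern x).
Proof.
move=> x0 t; apply/cvgrPdist_le => e e0; case: t => [r| |].
- have : (fun r : R => x / (x + Num.max r 0)) @ r --> x / (x + Num.max r 0).
    apply: cvgM; first exact: cvg_cst.
    apply: cvgV.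
      by rewrite gt_eqF// ltr_pwDl// le_max lexx orbT.
    apply: cvgD; first exact: cvg_cst.
    by apply: continuous_max; [exact: cvg_id|exact: cvg_cst].
  by move=> /cvgrPdist_le/(_ e e0).
- exists (Num.max 0 (x / e)); split; first exact: num_real.
  move=> [r| |] //=; last by rewrite subrr normr0 ltW.
  rewrite lte_fin gt_max => /andP[r0 hr].
  rewrite sub0r normrN (max_idPl (ltW r0)).
  rewrite ger0_norm; last by rewrite divr_ge0 ?addr_ge0// ltW.
  rewrite ler_pdivrMr ?addr_gt0//; move: hr; rewrite ltr_pdivrMr// => hr.
  by apply: (le_trans (ltW hr)); rewrite mulrC ler_wpM2l ?lerDr// ltW.
- exists 0; split; first exact: num_real.
  move=> [r| |] //=; last by rewrite subrr normr0 ltW.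
  rewrite lte_fin => r0; rewrite (max_idPr (ltW r0)) addr0 mulfV ?gt_eqF//.
  by rewrite subrr normr0 ltW.
Qed.

(** On the negative half-line, [psi_transform] at -1/x is this function
    minus 1, see [psi_phi]. *)
Definition phi (R : realType) (mu : probability R R) (x : R) : R :=
  \int[mu]_t kern x t%:E.

Lemma measurable_kern (R : realType) (x : R) : 0 < x ->
  measurable_fun setT (kern x \o EFin).
Proof.
move=> x0; apply: continuous_measurable_fun => r.
apply: continuous_comp; last exact: kern_continuous.
by move=> A.
Qed.

Lemma integrable_kern (R : realType) (mu : probability R R) (x : R) : 0 < x ->
  mu.-integrable setT (EFin \o (kern x \o EFin)).
Proof.
move=> x0; apply: (@probability_integrable_bounded _ _ _ _ _ 1) => [|t].
  exact: measurable_kern.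
by rewrite ger0_norm ?kern_le1// kern_ge0.
Qed.

Lemma Rintegral_cst_prob d (T : measurableType d) (R : realType)
  (P : probability T R) (r : R) : \int[P]_(_ in setT) r = r.
Proof.
rewrite Rintegral_cst// -[RHS]mulr1; congr (_ * _).
by rewrite [X in fine X](@probability_setT _ _ _ P).
Qed.

Lemma phi_le (R : realType) (mu : probability R R) (x y : R) :
  0 < x -> x <= y -> phi mu x <= phi mu y.
Proof.
move=> x0 xy; apply: le_Rintegral => //.
- exact: integrable_kern.
- exact/integrable_kern/(lt_le_trans x0).
- by move=> t _; have /andP[] := kern_lip t%:E x0 xy.
Qed.

Lemma phi_lip (R : realType) (mu : probability R R) (x y : R) :
  0 < x -> x <= y -> phi mu y <= phi mu x + (y - x) / x.
Proof.
move=> x0 xy; have y0 := lt_le_trans x0 xy.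
rewrite -[X in _ <= _ + X](Rintegral_cst_prob mu) -RintegralD//; first last.
- by apply: (@probability_integrable_bounded _ _ _ _ (fun=> _) `|(y - x) / x|).
- exact: integrable_kern.
apply: le_Rintegral => //; first exact: integrable_kern.
- apply: (@probability_integrable_bounded _ _ _ _ _ (1 + `|(y - x) / x|)) => [|t].
    by apply: measurable_funD => //; exact: measurable_kern.
  apply: (le_trans (ler_normD _ _)); rewrite lerD2r.
  by rewrite ger0_norm ?kern_le1// kern_ge0.
- by move=> t _; have /andP[] := kern_lip t%:E x0 xy.
Qed.

Lemma phi_continuous (R : realType) (mu : probability R R) (x : R) :
  0 < x -> {for x, continuous (phi mu)}.
Proof.
move=> x0; apply/cvgrPdist_le => e e0.
have x2 : 0 < x / 2 by rewrite divr_gt0.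
near=> y.
have yx2 : x / 2 < y by near: y; apply: (@cvgr_gt _ _ _ _ id x); [exact: cvg_id|]; rewrite ltr_pdivrMr// ltr_pMr// ltr1n.
have y0 : 0 < y by exact: lt_trans yx2.
have d : `|x - y| <= e * (x / 2).
  near: y; apply: (@cvgr_dist_le _ _ _ _ _ id x); first exact: cvg_id.
  by rewrite mulr_gt0.
have H (a b : R) : 0 < a -> a <= b -> x / 2 <= a -> b - a <= e * (x / 2) ->
    0 <= phi mu b - phi mu a <= e.
  move=> a0 ab xa bae; rewrite subr_ge0 phi_le//= lerBlDl.
  apply: le_trans (phi_lip mu a0 ab) _; rewrite lerD2l ler_pdivrMr//.
  by apply: (le_trans bae); rewrite ler_wpM2l// ltW.
have [xy|/ltW yx] := leP x y.
  have /andP[h1 h2] : 0 <= phi mu y - phi mu x <= e.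
    apply: H => //; first by lra.
    by apply: le_trans d; rewrite distrC ger0_norm// subr_ge0.
  by rewrite distrC ger0_norm.
have /andP[h1 h2] : 0 <= phi mu x - phi mu y <= e.
  apply: H => //; first exact: ltW.
  by apply: le_trans d; rewrite ger0_norm// subr_ge0.
by rewrite ger0_norm.
Unshelve. all: by end_near. Qed.

(** Both integrands agree for t >= 0, and the one on the right vanishes for
    t < 0. *)
Lemma psi_phi (R : realType) (mu : probability R R) (x : R) : 0 < x ->
  psi_transform mu (- x^-1) = phi mu x - 1.
Proof.
move=> x0; rewrite -[X in _ - X](Rintegral_cst_prob mu) -RintegralB//; first last.
- exact: (@probability_integrable_bounded _ _ _ _ (fun=> _) `|1|).
- exact: integrable_kern.
rewrite /psi_transform Rintegral_mkcond; apply: eq_Rintegral => t _.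
rewrite patchE /=; have [t0|t0] := leP 0 t.
  rewrite mem_set//.
  have xt : x + t != 0 by rewrite gt_eqF// ltr_pwDl.
  have -> : 1 - - x^-1 * t = (x + t) / x by field; rewrite gt_eqF.
  by field; rewrite xt gt_eqF.
rewrite memNset/=; last by rewrite leNgt t0.
by rewrite addr0 mulfV ?gt_eqF// subrr.
Qed.

Lemma on_nneg_neg (R : realType) (mu : probability R R) :
  on_nneg mu -> mu [set x | x < 0] = 0%E.
Proof.
move=> mu0; rewrite (_ : [set x | x < 0] = ~` [set x | 0 <= x]).
  rewrite probability_setC ?mu0 ?subee//.
  by rewrite (_ : mkset _ = `[0, +oo[%classic)//; apply/funext => x; rewrite /= in_itv/= andbT.
by apply/funext => x /=; apply/propext; rewrite ltNge; split=> /negP.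
Qed.

Lemma atom0E (R : realType) (mu : probability R R) : on_nneg mu ->
  atom0 mu = \int[mu]_t (\1_[set x : R | x <= 0] t).
Proof.
move=> mu0; rewrite /atom0 /Rintegral.
have mle : measurable [set x : R | x <= 0].
  by rewrite (_ : mkset _ = `]-oo, 0]%classic)//; apply/funext => x; rewrite /= in_itv.
rewrite integral_indic// setIT; congr fine.
have -> : [set x : R | x <= 0] = [set 0] `|` [set x | x < 0].
  apply/seteqP; split=> x /=; first by rewrite le_eqVlt => /orP[/eqP|]; [left|right].
  by case=> [->|/ltW].
rewrite measureU//=.
- by rewrite [X in (_ + X)%E]on_nneg_neg// adde0.
- by rewrite (_ : mkset _ = `]-oo, 0[%classic)//; apply/funext => x; rewrite /= in_itv.
- by apply/seteqP; split=> x //= [->]; rewrite ltxx.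
Qed.

Lemma measurable_le0 (R : realType) : measurable [set x : R | x <= 0].
Proof.
by rewrite (_ : mkset _ = `]-oo, 0]%classic)//; apply/funext => x; rewrite /= in_itv.
Qed.

Lemma atom0_le_phi (R : realType) (mu : probability R R) (x : R) :
  on_nneg mu -> 0 < x -> atom0 mu <= phi mu x.
Proof.
move=> mu0 x0; rewrite atom0E//; apply: le_Rintegral => //.
- apply: (@probability_integrable_bounded _ _ _ _ _ 1).
    by apply: measurable_indic; exact: measurable_le0.
  by move=> t; rewrite indicE; case: (_ \in _); rewrite ?normr1 ?normr0.
- exact: integrable_kern.
move=> t _; rewrite indicE; have [/set_mem /= t0|_] := boolP (t \in _).
  by rewrite (max_idPr t0) addr0 mulfV ?gt_eqF.
exact: kern_ge0.
Qed.

Lemma phi_le1 (R : realType) (mu : probability R R) (x : R) :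
  0 < x -> phi mu x <= 1.
Proof.
move=> x0; rewrite -[leRHS](Rintegral_cst_prob mu); apply: le_Rintegral => //.
- exact: integrable_kern.
- exact: (@probability_integrable_bounded _ _ _ _ (fun=> _) `|1|).
- by move=> t _; exact: kern_le1.
Qed.

Lemma phi_cvg_atom0 (R : realType) (mu : probability R R) : on_nneg mu ->
  phi mu n.+1%:R^-1 @[n --> \oo] --> atom0 mu.
Proof.
move=> mu0; rewrite atom0E//; apply: (@bounded_convergence _ _ _ _ _ _ 1).
- by move=> n; apply: measurable_kern; rewrite invr_gt0.
- by apply: measurable_indic; exact: measurable_le0.
- by move=> n u; rewrite ger0_norm ?kern_le1// ?kern_ge0// invr_gt0.
apply: aeW => t; rewrite indicE; have [/set_mem /= t0|] := boolP (t \in _).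
  rewrite (_ : (fun _ => _) = fun=> 1); first exact: cvg_cst.
  by apply/funext => n; rewrite (max_idPr t0) addr0 mulfV ?gt_eqF ?invr_gt0.
rewrite notin_setE /= => /negP; rewrite -ltNge => t0.
rewrite (max_idPl (ltW t0)).
have : (fun n => n.+1%:R^-1 + t) @ \oo --> (0 + t : R).
  by apply: cvgD; [exact: cvg_harmonic|exact: cvg_cst].
rewrite add0r => /(cvgV (lt0r_neq0 t0)) h.
by rewrite -[X in _ --> X](mul0r t^-1); apply: cvgM h; exact: cvg_harmonic.
Qed.

Lemma phi_cvg1 (R : realType) (mu : probability R R) :
  phi mu n.+1%:R @[n --> \oo] --> (1 : R).
Proof.
rewrite -[X in _ --> X](Rintegral_cst_prob mu 1).
apply: (@bounded_convergence _ _ _ _ _ _ 1).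
- by move=> n; apply: measurable_kern.
- exact: measurable_cst.
- by move=> n u; rewrite ger0_norm ?kern_le1// ?kern_ge0.
apply: aeW => t /=; set m := Num.max t 0.
have m0 : 0 <= m by rewrite le_max lexx orbT.
rewrite (_ : (fun _ => _) = fun n => (1 + n.+1%:R^-1 * m)^-1); last first.
  apply/funext => n; have h : n.+1%:R + m != 0 by rewrite gt_eqF// ltr_pwDl.
  have -> : 1 + n.+1%:R^-1 * m = (n.+1%:R + m) / n.+1%:R by field.
  by rewrite invf_div.
have : (fun n => 1 + n.+1%:R^-1 * m) @ \oo --> (1 + 0 * m : R).
  apply: cvgD; first exact: cvg_cst.
  by apply: cvgM; [exact: cvg_harmonic|exact: cvg_cst].
by rewrite mul0r addr0 => /(cvgV (oner_neq0 R)); rewrite invr1.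
Qed.

(** If phi took the same value twice, the increment of the kernel, which is
    positive for t > 0, would vanish almost everywhere and the law would be
    the unit mass at 0. *)
Lemma phi_lt (R : realType) (mu : probability R R) (x y : R) :
  on_nneg mu -> atom0 mu < 1 -> 0 < x -> x < y -> phi mu x < phi mu y.
Proof.
move=> mu0 a1 x0 xy; rewrite lt_neqAle phi_le ?ltW// andbT.
have y0 := lt_trans x0 xy.
apply: contraTneq a1 => phixy; rewrite -leNgt.
have ix := integrable_kern mu x0; have iy := integrable_kern mu y0.
pose f t := kern y t%:E - kern x t%:E.
have f0 t : 0 <= f t by rewrite subr_ge0; have /andP[] := kern_lip t%:E x0 (ltW xy).
have intf : \int[mu]_t f t = 0 by rewrite RintegralB// -/(phi mu y) -phixy subrr.
have mf : measurable_fun setT (EFin \o f).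
  by apply/measurable_EFinP; apply: measurable_funB; exact: measurable_kern.
have : (\int[mu]_t `|(EFin \o f) t| = 0)%E.
  have -> : (\int[mu]_t `|(EFin \o f) t|)%E = (\int[mu]_t (f t)%:E)%E.
    by apply: eq_integral => t _; rewrite /= ger0_norm.
  have ff : (\int[mu]_t (f t)%:E)%E \is a fin_num.
    apply: integrable_fin_num => //; apply: (@probability_integrable_bounded _ _ _ _ _ 1).
      exact/measurable_EFinP.
    move=> t; rewrite ger0_norm// lerBlDl ler_wpDl ?kern_ge0//; exact: kern_le1.
  by rewrite -(fineK ff) -[fine _]/(\int[mu]_t f t) intf.
move=> /(ae_eq_integral_abs _ measurableT mf) ae0.
rewrite atom0E// /Rintegral.
have -> : (\int[mu]_t (\1_[set x : R | x <= 0] t)%:E = \int[mu]_t (cst 1%E) t)%E.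
  apply: ae_eq_integral => //.
    by apply/measurable_EFinP/measurable_indic; exact: measurable_le0.
  apply: filterS ae0 => t /(_ Logic.I) /= [] /eqP; rewrite subr_eq0 => /eqP h _.
  rewrite indicE; have [t0|t0] := leP t 0; first by rewrite mem_set.
  exfalso; move: h; rewrite /kern (max_idPl (ltW t0)).
  have yt : y + t != 0 by rewrite gt_eqF// addr_gt0.
  have xt : x + t != 0 by rewrite gt_eqF// addr_gt0.
  move=> /(congr1 (fun z => z * ((y + t) * (x + t)))).
  have -> : y / (y + t) * ((y + t) * (x + t)) = y * (x + t) by field.
  have -> : x / (x + t) * ((y + t) * (x + t)) = x * (y + t) by field.
  have : 0 < (y - x) * t by rewrite mulr_gt0// subr_gt0.
  by rewrite mulrBl !mulrDr => ? ?; lra.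
have -> : fine (\int[mu]_t cst 1%E t) = 1 by exact: (Rintegral_cst_prob mu 1).
exact: lexx.
Qed.

Lemma phi_surj (R : realType) (mu : probability R R) (al : R) :
  on_nneg mu -> atom0 mu < al < 1 -> exists2 x, 0 < x & phi mu x = al.
Proof.
move=> mu0 /andP[a0 a1].
have [x [x0 xal]] : exists x : R, 0 < x /\ phi mu x < al.
  have := cvgr_lt _ (phi_cvg_atom0 mu0) _ a0 => -[N _ /(_ N (leqnn N))/= h].
  by exists N.+1%:R^-1; rewrite invr_gt0.
have [y [y0 yal]] : exists y : R, 0 < y /\ al < phi mu y.
  have := cvgr_gt _ (phi_cvg1 mu) _ a1 => -[N _ /(_ N (leqnn N))/= h].
  by exists N.+1%:R.
have xy : x <= y.
  by rewrite leNgt; apply/negP => /ltW /(phi_le mu y0); lra.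
have [|//|z] := @IVT R (phi mu) x y al xy.
- apply: continuous_in_subspaceT => z /set_mem /=; rewrite in_itv /= => /andP[xz _].
  by apply: phi_continuous; exact: lt_le_trans xz.
- by rewrite ge_min le_max (ltW xal) (ltW yal) orbT.
by rewrite in_itv /= => /andP[xz _] <-; exists z => //; exact: lt_le_trans xz.
Qed.

(** The value phi(x)-1 of [psi_transform] is attained at -1/x and, by
    [phi_lt], at no other negative point. *)
Lemma S_transform_phi (R : realType) (mu : probability R R) (x : R) :
  on_nneg mu -> atom0 mu < 1 -> 0 < x ->
  S_transform mu (phi mu x - 1) = phi mu x / ((1 - phi mu x) * x).
Proof.
move=> mu0 a1 x0; rewrite /S_transform.
have -> : chi_transform mu (phi mu x - 1) = - x^-1.
  have [|z0 zE] := @getPex _ [set z : R | z < 0 /\ psi_transform mu z = phi mu x - 1].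
    by exists (- x^-1); split; [rewrite oppr_lt0 invr_gt0|exact: psi_phi].
  rewrite /chi_transform; set z := get _ in z0 zE *.
  have nz0 : 0 < - z^-1 by rewrite oppr_gt0 invr_lt0.
  have := psi_phi mu nz0; rewrite invrN invrK opprK zE => /addIr e.
  have [lt|lt|->] := ltgtP x (- z^-1); last by rewrite invrN invrK opprK.
    by have := phi_lt mu0 a1 x0 lt; rewrite e ltxx.
  by have := phi_lt mu0 a1 nz0 lt; rewrite e ltxx.
by rewrite addrC subrK -(opprB 1) invrN !mulrN mulNr opprK invfM mulrA.
Qed.

(** * Moments from kernel means *)

Lemma sum_const_seq (V : nmodType) (I : Type) (s : seq I) (c : V) :
  \sum_(i <- s) c = c *+ size s.
Proof. by rewrite big_const_seq count_predT iter_addr_0. Qed.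

(** The average of p^k/(1+yp) is within 2|y| of the k-th moment, so the latter
    is a Cauchy sequence as y can be taken small. The identity
    p^(k+1)/(1+yp) = (p^k - p^k/(1+yp))/y then passes from k to k+1. *)
Lemma moments_of_kernel_means (R : realType) (ps : nat -> seq R) (Y : set R) :
  (forall n, size (ps n) = n) -> (forall n, in01 (ps n)) ->
  (forall d, 0 < d -> exists2 y, Y y & `|y| < d) ->
  (forall y, Y y -> 0 < `|y| <= 1 / 2) ->
  (forall y, Y y -> cvgn (fun n => (\sum_(p <- ps n) p / (1 + y * p)) / n%:R)) ->
  forall k, cvgn (fun n => (\sum_(p <- ps n) p ^+ k) / n%:R).
Proof.
move=> szp p01 Yacc Y2 Ycvg.
have den y p : Y y -> 0 <= p <= 1 -> 1 / 2 <= 1 + y * p.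
  move=> /Y2/andP[_ hy] /andP[p0 p1]; have : `|y * p| <= 1 / 2.
    by rewrite normrM (ger0_norm p0) (le_trans _ hy)// ler_piMr.
  by rewrite ler_norml => /andP[h _]; lra.
pose h k y n := (\sum_(p <- ps n) p ^+ k / (1 + y * p)) / n%:R.
pose m k n := (\sum_(p <- ps n) p ^+ k) / n%:R.
have hm k y n : Y y -> h k y n = m k n - y * h k.+1 y n.
  move=> Yy; rewrite /h /m mulrA -mulrBl mulr_sumr -sumrB; congr (_ / _).
  rewrite big_seq [RHS]big_seq; apply: eq_bigr => p /(allP (p01 n)) p01'.
  have := den _ _ Yy p01' => d; rewrite exprS.
  by field; rewrite gt_eqF//; lra.
have hbound k y n : Y y -> `|h k y n| <= 2.
  move=> Yy; have [->|n0] := posnP n; first by rewrite /h invr0 mulr0 normr0.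
  rewrite /h normrM normfV normr_nat ler_pdivrMr ?ltr0n//.
  apply: le_trans (ler_norm_sum _ _ _) _.
  rewrite -[X in _ <= _ * X%:R](szp n) mulr_natr -sum_const_seq.
  rewrite big_seq [leRHS]big_seq; apply: ler_sum => p /(allP (p01 n)) p01'.
  have d := den _ _ Yy p01'; have [p0 p1] := andP p01'.
  have d0 : 0 < 1 + y * p by apply: lt_le_trans d; rewrite divr_gt0.
  rewrite ger0_norm; last by rewrite divr_ge0 ?exprn_ge0// ltW.
  by rewrite ler_pdivrMr//; apply: (le_trans (exprn_ile1 k p0 p1)); lra.
have mh k : (forall y, Y y -> cvgn (h k y)) -> cvgn (m k).
  move=> hc; apply: cauchy_cvg; apply: cauchy_exP => e e0.
  have e4 : 0 < e / 4 by rewrite divr_gt0.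
  have [y Yy ye] := Yacc _ e4.
  exists (limn (h k y)); rewrite /= near_simpl.
  have e2 : 0 < e / 2 by rewrite divr_gt0.
  have /cvgrPdist_lt/(_ _ e2) := hc _ Yy.
  apply: filterS => n; rewrite -ball_normE /= => hn.
  have -> : limn (h k y) - m k n = (limn (h k y) - h k y n) - y * h k.+1 y n.
    by rewrite [in RHS]hm//; ring.
  apply: le_lt_trans (ler_normB _ _) _.
  have : `|y * h k.+1 y n| <= e / 4 * 2.
    by rewrite normrM ler_pM// ?hbound// ltW.
  by move=> ?; lra.
have hc k y : Y y -> cvgn (h k.+1 y).
  elim: k y => [|k IH] y Yy.
    rewrite (_ : h 1%N y = fun n => (\sum_(p <- ps n) p / (1 + y * p)) / n%:R).
      exact: Ycvg.
    by apply/funext.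
  have y0 : y != 0 by have /Y2/andP[] := Yy; rewrite normr_gt0.
  rewrite (_ : h k.+2 y = fun n => y^-1 * (m k.+1 n - h k.+1 y n)); last first.
    by apply/funext => n; rewrite (hm k.+1)//; field.
  apply: is_cvgM; first exact: is_cvg_cst.
  by apply: is_cvgB; [exact: mh|exact: IH].
case=> [|k]; last by apply: mh => y; exact: hc.
apply/cvg_ex; exists 1; apply: cvg_near_cst; near=> n.
have n0 : (0 < n)%N by near: n; exact: nbhs_infty_gt.
under eq_bigr do rewrite expr0.
by rewrite sum_const_seq szp mulfV// pnatr_eq0 -lt0n.
Unshelve. all: by end_near. Qed.

(** * Asymptotics of finite free multiplicative convolution *)

Definition nneg_list (R : realType) (n : nat) (ts : seq (\bar R)) :=
  size ts = n /\ all (fun t => 0 <= t)%E ts.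

Definition kmean (R : realType) (ts : seq (\bar R)) (x : R) : R :=
  (\sum_(t <- ts) kern x t) / (size ts)%:R.

(** The parameters w for which 1-w+wX is proportional to t+X. *)
Definition bern_params (R : realType) (ts : seq (\bar R)) : seq R := map (kern 1) ts.

Lemma exists_cube_lt (R : realType) (A B : R) : 0 < A -> A < B ->
  exists2 e : R, 0 < e & (1 + e) ^+ 3 * A < B.
Proof.
move=> A0 AB; pose e := Num.min 1 ((B - A) / (8 * A)).
have A8 : 0 < 8 * A by rewrite mulr_gt0.
have e0 : 0 < e by rewrite lt_min ltr01 divr_gt0// subr_gt0.
have e1 : e <= 1 by rewrite ge_min lexx.
have eA : e * (8 * A) <= B - A by rewrite -ler_pdivlMr// ge_min lexx orbT.
exists e => //.
have H : (1 + e) ^+ 3 <= 1 + 7 * e by nra.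
apply: (le_lt_trans (ler_wpM2r (ltW A0) H)).
have : 0 < e * A by rewrite mulr_gt0.
lra.
Qed.

Lemma kmean_bern (R : realType) n (ts : seq (\bar R)) (x : R) :
  nneg_list n ts -> (0 < n)%N -> 0 < x ->
  bern_mean (bern_params ts) x = kmean ts x * n%:R.
Proof.
move=> [szt t0] n0 x0; rewrite bern_mean_kern// /kmean szt mulfVK//.
by rewrite pnatr_eq0 -lt0n.
Qed.

Lemma kmean_lip (R : realType) (ts : seq (\bar R)) (x y : R) : 0 < x -> x <= y ->
  kmean ts x <= kmean ts y <= kmean ts x + (y - x) / x.
Proof.
move=> x0 xy; have [s0|s0] := posnP (size ts).
  by rewrite /kmean s0 invr0 !mulr0 add0r lexx divr_ge0 ?subr_ge0// ltW.
have s0' : 0 < (size ts)%:R :> R by rewrite ltr0n.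
rewrite /kmean ler_pM2r ?invr_gt0// ler_sum/=; last first.
  by move=> t _; have /andP[] := kern_lip t x0 xy.
rewrite ler_pdivrMr// mulrDl mulfVK ?gt_eqF// mulr_natr -sum_const_seq -big_split /=.
by apply: ler_sum => t _; have /andP[] := kern_lip t x0 xy.
Qed.

Lemma near_invn_le (R : realType) (c d : R) : 0 < d ->
  \forall n \near \oo, c / n%:R <= d.
Proof.
move=> d0; exists (Num.truncn (`|c| / d)).+1 => // n /= hn.
have n0 : 0 < n%:R :> R by rewrite ltr0n (leq_trans _ hn).
rewrite ler_pdivrMr//.
have cd : 0 <= `|c| / d by rewrite divr_ge0// ltW.
have /andP[_ h] := truncn_itv cd.
apply: le_trans (ler_norm c) _; rewrite mulrC -ler_pdivrMr//.
by apply: (le_trans (ltW h)); rewrite ler_nat.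
Qed.

Lemma truncn_mean (R : realType) (al : R) (n : nat) : 0 < al < 1 -> (0 < n)%N ->
  let k := Num.truncn (al * n%:R) in
  [/\ (k < n)%N, k%:R <= al * n%:R & al * n%:R <= k.+1%:R].
Proof.
move=> /andP[a0 a1] n0 k; have n0' : 0 < n%:R :> R by rewrite ltr0n.
have an0 : 0 <= al * n%:R by rewrite mulr_ge0 ?ltW.
have /andP[h1 /ltW h2] := truncn_itv an0; split=> //.
by rewrite -(ltr_nat R); apply: le_lt_trans h1 _; rewrite -[X in _ < X]mul1r ltr_pM2r.
Qed.

(** Asymptotic form of [finite_free_mult_mean_ge], at the index k = floor(al n). *)
Lemma free_mean_ge (R : realType) (us vs ws : nat -> seq (\bar R)) (x y z al be pu pv : R) :
  (forall n, nneg_list n (us n)) -> (forall n, nneg_list n (vs n)) ->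
  (forall n, nneg_list n (ws n)) ->
  (\forall n \near \oo, finite_free_mult n (bern_params (us n)) (bern_params (vs n)) (bern_params (ws n))) ->
  (\forall n \near \oo, exists2 d, al * n%:R < d%:R & 0 < (bern_poly (bern_params (ws n)))`_d) ->
  0 < x -> 0 < y -> 0 < z -> 0 < al < 1 -> be < al ->
  kmean (us n) y @[n --> \oo] --> pu -> kmean (vs n) z @[n --> \oo] --> pv ->
  al < pu -> al < pv -> y * z * (1 - al) < x * al ->
  \forall n \near \oo, be <= kmean (ws n) x.
Proof.
move=> us0 vs0 ws0 free top x0 y0 z0 al01 beal cu cv apu apv yzx.
have [a0 a1] := andP al01.
have A0 : 0 < y * z * (1 - al) by rewrite !mulr_gt0// subr_gt0.
have [e e0 eyz] := exists_cube_lt A0 yzx.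
pose dlt := x * al - (1 + e) ^+ 3 * (y * z * (1 - al)).
have d0 : 0 < dlt by rewrite subr_gt0.
near=> n.
have n0 : (0 < n)%N by near: n; exact: nbhs_infty_gt.
have n0' : 0 < n%:R :> R by rewrite ltr0n.
have nn : n%:R != 0 :> R by rewrite gt_eqF.
have [kn kal alk] := truncn_mean al01 n0.
set k := Num.truncn _ in kn kal alk.
have H1 : e^-1 / n%:R <= (pu - al) / 3 by near: n; apply: near_invn_le; lra.
have H2 : e^-1 / n%:R <= (pv - al) / 3 by near: n; apply: near_invn_le; lra.
have H3 : e^-1 / n%:R <= al - be by near: n; apply: near_invn_le; lra.
have H4 : (1 + e) ^+ 3 * (y * z) / n%:R <= dlt by near: n; exact: near_invn_le.
have Hu : al + (pu - al) / 2 < kmean (us n) y by near: n; apply: (cvgr_gt _ cu); lra.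
have Hv : al + (pv - al) / 2 < kmean (vs n) z by near: n; apply: (cvgr_gt _ cv); lra.
have [d dal ed] : exists2 d, al * n%:R < d%:R & 0 < (bern_poly (bern_params (ws n)))`_d.
  by near: n.
have kd : (k < d)%N by rewrite -(ltr_nat R); exact: le_lt_trans dal.
have fr : finite_free_mult n (bern_params (us n)) (bern_params (vs n)) (bern_params (ws n)) by near: n.
move: H1 H2 H3 H4; rewrite !(ler_pdivrMr _ _ n0') => H1 H2 H3 H4.
have := @finite_free_mult_mean_ge _ n _ _ _ x y z e k d (kern_in01 _ ltr01)
  (kern_in01 _ ltr01) (kern_in01 _ ltr01) fr x0 y0 z0 e0 kn kd ed.
rewrite -!/(bern_params _) (kmean_bern (us0 n))// (kmean_bern (vs0 n))// (kmean_bern (ws0 n))//.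
have Hu' : k%:R + e^-1 < kmean (us n) y * n%:R.
  have : (al + (pu - al) / 2) * n%:R < kmean (us n) y * n%:R by rewrite ltr_pM2r.
  have : 0 < (pu - al) * n%:R by rewrite mulr_gt0// subr_gt0.
  by move: kal H1; clear; lra.
have Hv' : k%:R + e^-1 < kmean (vs n) z * n%:R.
  have : (al + (pv - al) / 2) * n%:R < kmean (vs n) z * n%:R by rewrite ltr_pM2r.
  have : 0 < (pv - al) * n%:R by rewrite mulr_gt0// subr_gt0.
  by move: kal H2; clear; lra.
have Hx : (1 + e) ^+ 3 * (y * z * (n - k)%:R) <= x * k.+1%:R.
  apply: (@le_trans _ _ (x * (al * n%:R))); last by rewrite ler_wpM2l// ltW.
  have c0 : 0 <= (1 + e) ^+ 3 * (y * z) by rewrite !mulr_ge0 ?exprn_ge0 ?addr_ge0 ?ltW.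
  have : (n - k)%:R <= n%:R - al * n%:R + 1.
    by rewrite natrB ?(ltnW kn)//; move: alk; rewrite -natr1; clear; lra.
  move=> /(ler_wpM2l c0); move: H4; rewrite /dlt; move: ((1 + e) ^+ 3) => c; clear; lra.
move=> /(_ Hu' Hv' Hx) => H.
rewrite -(ler_pM2r n0'); apply: le_trans H; move: alk H3; clear; lra.
Unshelve. all: by end_near. Qed.

(** Asymptotic form of [finite_free_mult_mean_le]. The points y' and z' provide
    indices beyond k at which the coefficients of the factors do not vanish. *)
Lemma free_mean_le (R : realType) (us vs ws : nat -> seq (\bar R))
    (x y z al be pu pv y' z' pu' pv' : R) :
  (forall n, nneg_list n (us n)) -> (forall n, nneg_list n (vs n)) ->
  (forall n, nneg_list n (ws n)) ->
  (\forall n \near \oo, finite_free_mult n (bern_params (us n)) (bern_params (vs n)) (bern_params (ws n))) ->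
  0 < x -> 0 < y -> 0 < z -> 0 < al < 1 -> al < be ->
  kmean (us n) y @[n --> \oo] --> pu -> kmean (vs n) z @[n --> \oo] --> pv ->
  pu < al -> pv < al ->
  0 < y' -> 0 < z' ->
  kmean (us n) y' @[n --> \oo] --> pu' -> kmean (vs n) z' @[n --> \oo] --> pv' ->
  al < pu' -> al < pv' ->
  x * al < y * z * (1 - al) ->
  \forall n \near \oo, kmean (ws n) x <= be.
Proof.
move=> us0 vs0 ws0 free x0 y0 z0 al01 albe cu cv apu apv y0' z0' cu' cv' apu' apv' yzx.
have [a0 a1] := andP al01.
have A0 : 0 < x * al by rewrite !mulr_gt0.
have [e e0 eyz] := exists_cube_lt A0 yzx.
pose dlt := y * z * (1 - al) - (1 + e) ^+ 3 * (x * al).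
have d0 : 0 < dlt by rewrite subr_gt0.
near=> n.
have n0 : (0 < n)%N by near: n; exact: nbhs_infty_gt.
have n0' : 0 < n%:R :> R by rewrite ltr0n.
have nn : n%:R != 0 :> R by rewrite gt_eqF.
have [kn kal alk] := truncn_mean al01 n0.
set k := Num.truncn _ in kn kal alk.
have H1 : e^-1 / n%:R <= (al - pu) / 3 by near: n; apply: near_invn_le; lra.
have H2 : e^-1 / n%:R <= (al - pv) / 3 by near: n; apply: near_invn_le; lra.
have H3 : e^-1 / n%:R <= be - al by near: n; apply: near_invn_le; lra.
have H4 : (1 + e) ^+ 3 * x / n%:R <= dlt by near: n; exact: near_invn_le.
have Hu : kmean (us n) y < al - (al - pu) / 2 by near: n; apply: (cvgr_lt _ cu); lra.
have Hv : kmean (vs n) z < al - (al - pv) / 2 by near: n; apply: (cvgr_lt _ cv); lra.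
have Hu1 : al < kmean (us n) y' by near: n; apply: (cvgr_gt _ cu').
have Hv1 : al < kmean (vs n) z' by near: n; apply: (cvgr_gt _ cv').
have fr : finite_free_mult n (bern_params (us n)) (bern_params (vs n)) (bern_params (ws n)) by near: n.
move: H1 H2 H3 H4; rewrite !(ler_pdivrMr _ _ n0') => H1 H2 H3 H4.
have [du kdu eu] : exists2 d, (k < d)%N & 0 < (bern_poly (bern_params (us n)))`_d.
  apply: (coef_bern_gt0_of_mean (kern_in01 _ ltr01) y0').
  rewrite -/(bern_params _) (kmean_bern (us0 n))//; apply: le_lt_trans kal _.
  by rewrite ltr_pM2r.
have [dv kdv ev] : exists2 d, (k < d)%N & 0 < (bern_poly (bern_params (vs n)))`_d.
  apply: (coef_bern_gt0_of_mean (kern_in01 _ ltr01) z0').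
  rewrite -/(bern_params _) (kmean_bern (vs0 n))//; apply: le_lt_trans kal _.
  by rewrite ltr_pM2r.
have := @finite_free_mult_mean_le _ n _ _ _ x y z e k du dv (kern_in01 _ ltr01)
  (kern_in01 _ ltr01) (kern_in01 _ ltr01) fr x0 y0 z0 e0 kn (ltnW kdu) eu (ltnW kdv) ev.
rewrite -!/(bern_params _) (kmean_bern (us0 n))// (kmean_bern (vs0 n))// (kmean_bern (ws0 n))//.
have Hu' : kmean (us n) y * n%:R < k.+1%:R - e^-1.
  have : kmean (us n) y * n%:R < (al - (al - pu) / 2) * n%:R by rewrite ltr_pM2r.
  have : 0 < (al - pu) * n%:R by rewrite mulr_gt0// subr_gt0.
  by move: alk H1; clear; lra.
have Hv' : kmean (vs n) z * n%:R < k.+1%:R - e^-1.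
  have : kmean (vs n) z * n%:R < (al - (al - pv) / 2) * n%:R by rewrite ltr_pM2r.
  have : 0 < (al - pv) * n%:R by rewrite mulr_gt0// subr_gt0.
  by move: alk H2; clear; lra.
have Hx : (1 + e) ^+ 3 * (x * k.+1%:R) <= y * z * (n - k)%:R.
  apply: (@le_trans _ _ (y * z * (n%:R - al * n%:R))); last first.
    by rewrite ler_wpM2l ?mulr_ge0 ?(ltW y0) ?(ltW z0)// natrB ?(ltnW kn)// lerD2l lerN2.
  have c0 : 0 <= (1 + e) ^+ 3 * x by rewrite !mulr_ge0 ?exprn_ge0 ?addr_ge0 ?ltW.
  have : k.+1%:R <= al * n%:R + 1 by rewrite -natr1 lerD2r.
  move=> /(ler_wpM2l c0); move: H4; rewrite /dlt; move: ((1 + e) ^+ 3) => c; clear; lra.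
move=> /(_ Hu' Hv' Hx) => H.
rewrite -(ler_pM2r n0'); apply: (le_trans H); move: kal H3; clear; lra.
Unshelve. all: by end_near. Qed.

(** Lists [us] and [vs] converging weakly to [mu] and [nu], tested on the
    kernels only, and their finite free multiplicative convolutions [ws]. The
    field [free_top] keeps the degree of the latter asymptotically n, that is,
    it prevents zeros from escaping to infinity. *)
Record free_limit_setting (R : realType) (mu nu : probability R R)
    (us vs ws : nat -> seq (\bar R)) : Prop := FreeLimitSetting {
  left_nneg : on_nneg mu;
  right_nneg : on_nneg nu;
  left_list : forall n, nneg_list n (us n);
  right_list : forall n, nneg_list n (vs n);
  free_list : forall n, nneg_list n (ws n);
  free_mult : \forall n \near \oo,
    finite_free_mult n (bern_params (us n)) (bern_params (vs n)) (bern_params (ws n));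
  free_top : forall al : R, al < 1 -> \forall n \near \oo,
    exists2 d, al * n%:R < d%:R & 0 < (bern_poly (bern_params (ws n)))`_d;
  left_cvg : forall x, 0 < x -> kmean (us n) x @[n --> \oo] --> phi mu x;
  right_cvg : forall x, 0 < x -> kmean (vs n) x @[n --> \oo] --> phi nu x }.

Lemma finite_free_multC (R : realFieldType) n (us vs ws : seq R) :
  finite_free_mult n us vs ws -> finite_free_mult n vs us ws.
Proof. by move=> [C C0 H]; exists C => // k kn; rewrite H// [X in _ * X]mulrC. Qed.

Lemma free_limit_settingC (R : realType) (mu nu : probability R R) us vs ws :
  free_limit_setting mu nu us vs ws -> free_limit_setting nu mu vs us ws.
Proof.
case=> *; split=> //.
by near=> n; apply: finite_free_multC; near: n.
Unshelve. all: by end_near. Qed.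

Lemma phi_gt_exists (R : realType) (mu : probability R R) (al : R) : al < 1 ->
  exists2 x, 0 < x & al < phi mu x.
Proof.
move=> a1; have := cvgr_gt _ (phi_cvg1 mu) _ a1 => -[N _ /(_ N (leqnn N))/= h].
by exists N.+1%:R.
Qed.

Lemma atom0_ge0 (R : realType) (mu : probability R R) : 0 <= atom0 mu.
Proof. by rewrite /atom0 fine_ge0. Qed.

(** If [mu] has an atom at 0 then the mean for [us] stays above any level below
    its mass even at tiny y; this makes y z (1-al) as small as desired. *)
Lemma free_kmean_ge_atom0 (R : realType) (mu nu : probability R R) us vs ws (x be : R) :
  free_limit_setting mu nu us vs ws -> 0 < x -> be < Num.max (atom0 mu) (atom0 nu) ->
  \forall n \near \oo, be <= kmean (ws n) x.
Proof.
wlog nm : mu nu us vs / atom0 nu <= atom0 mu.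
  move=> H S x0 bm; have [nm|/ltW mn] := leP (atom0 nu) (atom0 mu).
    by apply: (H mu nu us vs) => //.
  by apply: (H nu mu vs us) => //; [exact: free_limit_settingC|rewrite maxC].
move=> S x0; rewrite (max_idPl nm) => bm.
have mu0 := left_nneg S; have nu0 := right_nneg S.
have am1 : atom0 mu <= 1 by apply: le_trans (atom0_le_phi mu0 ltr01) (phi_le1 _ ltr01).
have [b0|b0] := leP be 0.
  apply: nearW => n; apply: (le_trans b0); rewrite /kmean divr_ge0//.
  by apply: sumr_ge0 => t _; exact: kern_ge0.
pose al := (be + atom0 mu) / 2.
have beal : be < al by rewrite /al; lra.
have ala : al < atom0 mu by rewrite /al; lra.
have al0 : 0 < al by exact: lt_trans beal.
have al1 : al < 1 by exact: lt_le_trans am1.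
have [z z0 alz] := phi_gt_exists nu al1.
(* chosen so that y z (1-al) <= x al / 2 *)
pose y := x * al / (2 * z).
have y0 : 0 < y by rewrite divr_gt0// mulr_gt0.
have yE : y * z = x * al / 2 by rewrite /y; field; rewrite gt_eqF.
apply: (@free_mean_ge _ us vs ws x y z al be (phi mu y) (phi nu z)) => //.
- exact: left_list S.
- exact: right_list S.
- exact: free_list S.
- exact: free_mult S.
- exact: free_top S _ al1.
- by rewrite al0.
- exact: left_cvg S _ y0.
- exact: right_cvg S _ z0.
- by apply: lt_le_trans ala _; exact: atom0_le_phi.
rewrite yE; have : 0 < x * al by rewrite mulr_gt0.
nra.
Qed.

(** Compare with nearby points X q^3 and X / q^3, for which y and z can be
    replaced by strictly larger, respectively smaller, ones; the relative
    Lipschitz bound brings the comparison back to X. *)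
Lemma free_kmean_cvg (R : realType) (mu nu : probability R R) us vs ws (y z al : R) :
  free_limit_setting mu nu us vs ws ->
  Num.max (atom0 mu) (atom0 nu) < al < 1 -> 0 < y -> 0 < z ->
  phi mu y = al -> phi nu z = al ->
  kmean (ws n) (y * z * (1 - al) / al) @[n --> \oo] --> al.
Proof.
move=> S; rewrite gt_max => /andP[/andP[amu anu] a1] y0 z0 ym zn.
have mu0 := left_nneg S; have nu0 := right_nneg S.
have a0 : 0 < al by apply: le_lt_trans (atom0_ge0 mu) amu.
have am1 := lt_trans amu a1; have an1 := lt_trans anu a1.
set X := y * z * (1 - al) / al.
have X0 : 0 < X by rewrite /X divr_gt0// !mulr_gt0// subr_gt0.
have XE : X * al = y * z * (1 - al) by rewrite /X mulfVK ?gt_eqF.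
have [y' y'0 ly'] := phi_gt_exists mu a1; have [z' z'0 lz'] := phi_gt_exists nu a1.
have al01 : 0 < al < 1 by rewrite a0.
apply/cvgrPdist_le => e e0.
pose d := e / 2; have d0 : 0 < d by rewrite divr_gt0.
(* q^3 < 1 + d: both Lipschitz errors below are q^3 - 1 *)
have [p p0 pd] := @exists_cube_lt R 1 (1 + d) ltr01 (ltac:(lra)).
pose q := 1 + p; have q1 : 1 < q by rewrite /q; lra.
have q0 : 0 < q by lra.
have q30 : 0 < q ^+ 3 by rewrite exprn_gt0.
have qd : q ^+ 3 < 1 + d by rewrite -[q ^+ 3]mulr1.
have q31 : 1 <= q ^+ 3 by rewrite exprn_ege1// ltW.
near=> n.
have L : al - d <= kmean (ws n) (X * q ^+ 3).
  near: n; apply: (@free_mean_ge _ us vs ws _ (y * q) (z * q) al _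
    (phi mu (y * q)) (phi nu (z * q))) => //.
  - exact: left_list S.
  - exact: right_list S.
  - exact: free_list S.
  - exact: free_mult S.
  - exact: free_top S _ a1.
  - by rewrite mulr_gt0// exprn_gt0.
  - by rewrite mulr_gt0.
  - by rewrite mulr_gt0.
  - by rewrite ltrBlDr ltrDl.
  - by apply: (left_cvg S); rewrite mulr_gt0.
  - by apply: (right_cvg S); rewrite mulr_gt0.
  - by rewrite -ym; apply: phi_lt => //; rewrite ltr_pMr.
  - by rewrite -zn; apply: phi_lt => //; rewrite ltr_pMr.
  rewrite [ltRHS](_ : _ = q ^+ 3 * (X * al)); last by ring.
  rewrite XE [ltLHS](_ : _ = q ^+ 2 * (y * z * (1 - al))); last by ring.
  rewrite ltr_pM2r; last by rewrite !mulr_gt0// subr_gt0.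
  by rewrite ltr_eXn2l.
have U : kmean (ws n) (X / q ^+ 3) <= al + d.
  near: n; apply: (@free_mean_le _ us vs ws _ (y / q) (z / q) al _
    (phi mu (y / q)) (phi nu (z / q)) y' z' (phi mu y') (phi nu z')) => //.
  - exact: left_list S.
  - exact: right_list S.
  - exact: free_list S.
  - exact: free_mult S.
  - by rewrite divr_gt0// exprn_gt0.
  - by rewrite divr_gt0.
  - by rewrite divr_gt0.
  - by rewrite ltrDl.
  - by apply: (left_cvg S); rewrite divr_gt0.
  - by apply: (right_cvg S); rewrite divr_gt0.
  - rewrite -ym; apply: phi_lt => //; first by rewrite divr_gt0.
    by rewrite ltr_pdivrMr// ltr_pMr.
  - rewrite -zn; apply: phi_lt => //; first by rewrite divr_gt0.
    by rewrite ltr_pdivrMr// ltr_pMr.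
  - exact: (left_cvg S).
  - exact: (right_cvg S).
  rewrite mulrAC XE [ltRHS](_ : _ = y * z * (1 - al) * q / q ^+ 3); last first.
    by field; rewrite gt_eqF.
  rewrite ltr_pM2r ?invr_gt0// ltr_pMr//.
  by rewrite !mulr_gt0// subr_gt0.
have Xq : X <= X * q ^+ 3 by rewrite ler_peMr// ltW.
have Xq' : X / q ^+ 3 <= X by rewrite ler_pdivrMr.
have Xq0 : 0 < X / q ^+ 3 by rewrite divr_gt0.
have /andP[_ h1] := kmean_lip (ws n) X0 Xq.
have /andP[_ h2] := kmean_lip (ws n) Xq0 Xq'.
have e1 : (X * q ^+ 3 - X) / X = q ^+ 3 - 1 by field; rewrite gt_eqF.
have e2 : (X - X / q ^+ 3) / (X / q ^+ 3) = q ^+ 3 - 1.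
  by field; rewrite !gt_eqF.
rewrite e1 in h1; rewrite e2 in h2.
have ed : e = d + d by exact: splitr.
rewrite ler_norml; move: L U h1 h2 qd ed; clear => *; apply/andP; split; lra.
Unshelve. all: by end_near. Qed.

(** * The limit measure *)

(** Inverse of [kern x0] on [0,+oo], extended continuously to the real line. *)
Definition unkern (R : realType) (x0 p : R) : \bar R :=
  if p <= 0 then +oo%E else (x0 * (1 - p) / p)%:E.

Lemma unkernK (R : realType) (x0 : R) t : 0 < x0 -> (0 <= t)%E ->
  unkern x0 (kern x0 t) = t.
Proof.
move=> x00; case: t => [r| |] //=; last by rewrite /unkern lexx.
rewrite lee_fin => r0; rewrite (max_idPl r0).
have xr : 0 < x0 + r by rewrite ltr_pwDl.
rewrite /unkern leNgt divr_gt0//=; congr (_%:E); field.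
by rewrite gt_eqF//= gt_eqF.
Qed.

Lemma unkern_continuous (R : realType) (x0 : R) : 0 < x0 -> continuous (unkern x0).
Proof.
move=> x00 p; suff : unkern x0 q @[q --> p] --> unkern x0 p by [].
have [p0|p0|->] := ltgtP p 0.
- have H : \forall q \near p, unkern x0 q = +oo%E.
    near=> q; rewrite /unkern ifT//; apply: ltW; near: q.
    by apply: (@cvgr_lt _ _ _ _ id p) => //; exact: cvg_id.
  rewrite [X in _ --> X](_ : _ = +oo%E); last by rewrite /unkern (ltW p0).
  exact: cvg_near_cst H.
- rewrite [X in _ --> X](_ : _ = (x0 * (1 - p) / p)%:E); last by rewrite /unkern leNgt p0.
  apply: (@cvg_trans _ ((x0 * (1 - q) / q)%:E @[q --> p])).
    apply: near_eq_cvg; near=> q; rewrite /unkern leNgt ifF//; apply/negbF.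
    by near: q; apply: (@cvgr_gt _ _ _ _ id p) => //; exact: cvg_id.
  have h : (fun q => x0 * (1 - q) / q) @ p --> x0 * (1 - p) / p.
    apply: cvgM; last by apply: cvgV; [rewrite gt_eqF|exact: cvg_id].
    apply: cvgM; first exact: cvg_cst.
    by apply: cvgB; [exact: cvg_cst|exact: cvg_id].
  by apply: cvg_comp h _ => A.
- rewrite {2}/unkern lexx; apply/cvgeyPgt => A; near=> q.
  rewrite /unkern; have [//|q0] := leP q 0; first by rewrite ltry.
  rewrite lte_fin.
  have A1 : 0 < `|A| + 1 by rewrite ltr_pwDr.
  have q1 : q <= 1 / 2.
    near: q; apply: (@cvgr_le _ _ _ _ id 0); [exact: cvg_id|by rewrite divr_gt0].
  have q2 : q <= x0 / (2 * (`|A| + 1)).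
    near: q; apply: (@cvgr_le _ _ _ _ id 0); first exact: cvg_id.
    by rewrite divr_gt0// mulr_gt0.
  rewrite ltr_pdivlMr//.
  have : q * (2 * (`|A| + 1)) <= x0 by rewrite -ler_pdivlMr// mulr_gt0.
  have : A * q <= `|A| * q by rewrite ler_wpM2r ?ler_norm// ltW.
  have : x0 * (1 / 2) <= x0 * (1 - q) by rewrite ler_wpM2l ?(ltW x00)//; lra.
  by move: (`|A|) => B ? ? ?; lra.
Unshelve. all: by end_near. Qed.

(** With p = x0/(x0+t) the kernel at x0(1+y) is (1+y) p/(1+yp), which brings
    the lists under [moments_of_kernel_means]. *)
Lemma weak_limit_of_kmean (R : realType) (ws : nat -> seq (\bar R)) (x0 : R) :
  (forall n, nneg_list n (ws n)) -> 0 < x0 ->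
  (forall d, 0 < d -> exists x, [/\ 0 < x, x != x0, `|x - x0| < d &
     cvgn (fun n => kmean (ws n) x)]) ->
  exists g : R -> R, [/\ measurable_fun setT g, forall u, 0 <= g u <= 1 &
    forall f : \bar R -> R, continuous f ->
      (\sum_(t <- ws n) f t) / n%:R @[n --> \oo] -->
      \int[uniform_prob (@ltr01 R)]_u f (unkern x0 (g u))].
Proof.
move=> ws0 x00 acc.
pose ps n := map (kern x0) (ws n).
(* the relative displacements y for which the mean at x0 (1+y) converges *)
pose Y := [set y : R | 0 < `|y| <= 1 / 2 /\ cvgn (fun n => kmean (ws n) (x0 * (1 + y)))].
have szp n : size (ps n) = n by rewrite size_map; have [] := ws0 n.
have p01 n : in01 (ps n) by exact: kern_in01.
have mom k : cvgn (fun n => (\sum_(p <- ps n) p ^+ k) / n%:R).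
  apply: (@moments_of_kernel_means _ ps Y) => //.
  - move=> d d0; have d1 : 0 < x0 * Num.min d (1 / 2).
      by rewrite mulr_gt0// lt_min d0 divr_gt0.
    have [x [xp xx0 xd xc]] := acc _ d1.
    have E : `|x / x0 - 1| < Num.min d (1 / 2).
      rewrite -(ltr_pM2l x00); apply: le_lt_trans xd.
      by rewrite -{1}(gtr0_norm x00) -normrM mulrBr mulr1 mulrCA mulfV ?gt_eqF// mulr1.
    move: E; rewrite lt_min => /andP[E1 E2].
    exists (x / x0 - 1) => //; split.
      rewrite (ltW E2) andbT normr_gt0 subr_eq0; apply: contra xx0.
      by move=> /eqP h; rewrite -[x](mulfVK (lt0r_neq0 x00)) h mul1r.
    by rewrite addrC subrK mulrCA mulfV ?gt_eqF// mulr1.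
  - by move=> y [].
  move=> y [/andP[y0 y2] cy].
  have y1 : 0 < 1 + y by move: y2; rewrite ler_norml; lra.
  rewrite (_ : (fun n => _) = fun n => kmean (ws n) (x0 * (1 + y)) * (1 + y)^-1).
    by apply: is_cvgM => //; exact: is_cvg_cst.
  apply/funext => n; have [szw /allP w0] := ws0 n.
  rewrite /kmean /ps big_map szw mulrAC; congr (_ / _).
  rewrite mulr_suml big_seq [RHS]big_seq; apply: eq_bigr => t /w0.
  case: t => [r| |] //=; last by rewrite !mul0r.
  rewrite lee_fin => r0; rewrite (max_idPl r0).
  have d1 : 0 < x0 + r by rewrite ltr_pwDl.
  have d2 : 0 < x0 * (1 + y) + r by rewrite ltr_pwDl// mulr_gt0.
  by field; rewrite !gt_eqF.
have [g [mg g01 gcvg]] := moment_limit szp p01 mom.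
exists g; split=> // f cf.
have cF : continuous (f \o unkern x0).
  by move=> p; apply: continuous_comp; [exact: unkern_continuous|exact: cf].
rewrite (_ : (fun n => _) = fun n => (\sum_(p <- ps n) (f \o unkern x0) p) / n%:R).
  exact: gcvg.
apply/funext => n; have [szw /allP w0] := ws0 n.
rewrite /ps big_map big_seq [in RHS]big_seq; congr (_ / _).
by apply: eq_bigr => t /w0 t0; rewrite /= unkernK.
Qed.

Lemma measurable_fine_unkern (R : realType) (x0 : R) :
  measurable_fun setT (fun p : R => fine (unkern x0 p)).
Proof.
rewrite (_ : (fun p => _) = fun p : R => if p <= 0 then 0 else x0 * (1 - p) / p); last first.
  by apply/funext => p; rewrite /unkern; case: ifP.
apply: measurable_fun_if => //.
- by apply: measurable_fun_ler => //; exact: measurable_id.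
- rewrite setTI (_ : _ @^-1` _ = `]0, +oo[%classic); last first.
    by apply/funext => p; rewrite /= in_itv /= andbT ltNge; apply/propext; split=> [->//|/negbTE].
  apply: open_continuous_measurable_fun; first exact: interval_open.
  move=> p; rewrite inE /= in_itv /= andbT => p0.
  apply: cvgM; last by apply: cvgV; [rewrite gt_eqF|exact: cvg_id].
  apply: cvgM; first exact: cvg_cst.
  by apply: cvgB; [exact: cvg_cst|exact: cvg_id].
Qed.

Lemma kmean_le1 (R : realType) (ts : seq (\bar R)) (x : R) : 0 < x -> kmean ts x <= 1.
Proof.
move=> x0; have [s0|s0] := posnP (size ts); first by rewrite /kmean s0 invr0 mulr0.
rewrite /kmean ler_pdivrMr ?ltr0n// mul1r -sum_const_seq.
by apply: ler_sum => t _; exact: kern_le1.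
Qed.

Lemma kmean_cvg_le (R : realType) (ws : nat -> seq (\bar R)) (x y a b : R) :
  0 < x -> x <= y -> kmean (ws n) x @[n --> \oo] --> a ->
  kmean (ws n) y @[n --> \oo] --> b -> a <= b.
Proof.
move=> x0 xy ca cb; apply: (ler_cvg_to ca cb); apply: nearW => n.
by have /andP[] := kmean_lip (ws n) x0 xy.
Qed.

Lemma free_kmean_level (R : realType) (mu nu : probability R R) us vs ws (al : R) :
  free_limit_setting mu nu us vs ws -> Num.max (atom0 mu) (atom0 nu) < al < 1 ->
  exists2 X, 0 < X & kmean (ws n) X @[n --> \oo] --> al.
Proof.
move=> S al01; have := al01; rewrite gt_max => /andP[/andP[amu anu] a1].
have [y y0 ym] := phi_surj (left_nneg S) (introT andP (conj amu a1)).
have [z z0 zn] := phi_surj (right_nneg S) (introT andP (conj anu a1)).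
exists (y * z * (1 - al) / al); last exact: free_kmean_cvg S al01 y0 z0 ym zn.
have a0' : 0 < al by apply: le_lt_trans (atom0_ge0 mu) amu.
by rewrite divr_gt0// !mulr_gt0// subr_gt0.
Qed.

Lemma free_kmean_full (R : realType) (mu nu : probability R R) us vs ws (x : R) :
  free_limit_setting mu nu us vs ws -> 1 <= Num.max (atom0 mu) (atom0 nu) -> 0 < x ->
  kmean (ws n) x @[n --> \oo] --> (1 : R).
Proof.
move=> S a1 x0; apply/cvgrPdist_le => e e0; near=> n.
have h1 : kmean (ws n) x <= 1 by exact: kmean_le1.
have h2 : 1 - e <= kmean (ws n) x.
  by near: n; apply: (free_kmean_ge_atom0 S x0); apply: lt_le_trans a1; lra.
by rewrite ger0_norm; lra.
Unshelve. all: by end_near. Qed.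

(** The points X belonging to levels al < a2 increase strictly with al, because
    the limits of the means at these points are different; so they accumulate
    at their supremum. When an atom at 0 has mass 1, every point works. *)
Lemma free_kmean_acc (R : realType) (mu nu : probability R R) us vs ws :
  free_limit_setting mu nu us vs ws -> exists2 x0 : R, 0 < x0 &
  forall d, 0 < d -> exists x, [/\ 0 < x, x != x0, `|x - x0| < d &
     cvgn (fun n => kmean (ws n) x)].
Proof.
move=> S; set a0 := Num.max (atom0 mu) (atom0 nu).
have [a1|a1] := leP 1 a0.
  exists 1 => // d d0; exists (1 + d / 2); split.
  - by lra.
  - by rewrite gt_eqF//; lra.
  - by rewrite addrC addKr gtr0_norm; lra.
  - by apply/cvg_ex; exists 1; apply: free_kmean_full S _ _ => //; lra.
pose a2 := (a0 + 1) / 2.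
have a02 : a0 < a2 < 1 by rewrite /a2; lra.
have [X2 X20 X2c] := free_kmean_level S a02.
(* levels below a2 only, so that X2 bounds E and the limits stay below a2 *)
pose E := [set x : R | 0 < x /\ exists2 al, a0 < al < a2 &
  kmean (ws n) x @[n --> \oo] --> al].
have Eex al : a0 < al < a2 -> exists2 x, 0 < x & kmean (ws n) x @[n --> \oo] --> al.
  by move=> h; apply: free_kmean_level S _; rewrite -/a0; move: h a02; lra.
have Eub x : E x -> x <= X2.
  move=> [x0 [al /andP[_ hal] xc]]; rewrite leNgt; apply/negP => /ltW X2x.
  by have := kmean_cvg_le X20 X2x X2c xc; rewrite leNgt hal.
have [x1 x10 x1c] : exists2 x, 0 < x & kmean (ws n) x @[n --> \oo] --> (a0 + a2) / 2.
  by apply: Eex; move: a02; lra.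
have Ex1 : E x1 by split=> //; exists ((a0 + a2) / 2) => //; move: a02; lra.
have hE : has_sup E by split; [exists x1|exists X2 => x /Eub].
have x0s x : E x -> x <= sup E by move=> Ex; apply: sup_upper_bound.
exists (sup E); first exact: lt_le_trans x10 (x0s _ Ex1).
move=> d d0; have [x Ex dx] := sup_adherent d0 hE.
have [x0 [al /andP[a0al ala2] xc]] := Ex.
have xs := x0s _ Ex.
exists x; split=> //; last by apply/cvg_ex; exists al.
  apply/negP => /eqP xE.
  have [|x' x'0 x'c] := Eex ((al + a2) / 2); first by lra.
  have Ex' : E x' by split=> //; exists ((al + a2) / 2) => //; lra.
  have := x0s _ Ex'; rewrite -xE => x'x.
  by have := kmean_cvg_le x'0 x'x x'c xc; lra.
by rewrite distrC ger0_norm ?subr_ge0//; lra.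
Qed.

(** Tightness at +oo: no mass of the limit law can sit there. *)
Lemma free_kmean_near1 (R : realType) (mu nu : probability R R) us vs ws (al : R) :
  free_limit_setting mu nu us vs ws -> al < 1 ->
  exists x l, [/\ 0 < x, al <= l & kmean (ws n) x @[n --> \oo] --> l].
Proof.
move=> S al1; set a0 := Num.max (atom0 mu) (atom0 nu).
have [a1|a1] := leP 1 a0.
  by exists 1, 1; split=> //; [exact: ltW|exact: (free_kmean_full S)].
pose m := Num.max al a0.
have m1 : m < 1 by rewrite /m gt_max al1 a1.
have m0 : a0 <= m by rewrite /m le_max lexx orbT.
have mal : al <= m by rewrite /m le_max lexx.
have h : a0 < (m + 1) / 2 < 1 by lra.
have [X X0 Xc] := free_kmean_level S h.
by exists X, ((m + 1) / 2); split=> //; lra.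
Qed.

Lemma law_exists d (T : measurableType d) (R : realType) (P : probability T R)
    (X : T -> R) : measurable_fun setT X ->
  exists rho : probability R R, (forall A, rho A = P (X @^-1` A)) /\
    forall (f : R -> R) (M : R), measurable_fun setT f -> (forall t, `|f t| <= M) ->
      \int[rho]_t f t = \int[P]_u f (X u).
Proof.
move=> mX; pose Xrv : {RV P >-> R} := HB.pack X (isMeasurableFun.Build _ _ _ _ _ mX).
exists (distribution P Xrv); split=> // f M mf fM.
rewrite /Rintegral integral_distribution//; first exact/measurable_EFinP.
apply: (@probability_integrable_bounded _ _ _ _ _ M) => [|u]; last exact: fM.
exact: measurableT_comp mf mX.
Qed.

(** Since k vanishes on A, its integral is at most 1 - P(A). *)
Lemma zero_mass_of_kern d (T : measurableType d) (R : realType) (P : probability T R)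
    (k : R -> T -> R) (A : set T) :
  measurable A -> (forall x, 0 < x -> measurable_fun setT (k x)) ->
  (forall x u, 0 < x -> 0 <= k x u <= 1) ->
  (forall x u, A u -> k x u = 0) ->
  (forall al : R, al < 1 -> exists2 x, 0 < x & al <= \int[P]_u k x u) ->
  P A = 0%E.
Proof.
move=> mA mk k01 kA kal.
have PAf : P A \is a fin_num.
  by rewrite ge0_fin_numE//; apply: (@le_lt_trans _ _ 1%E); [exact: probability_le1|exact: ltry].
rewrite -(fineK PAf); congr (_%:E); apply/le_anti; rewrite fine_ge0// andbT.
apply/ler_addgt0Pr => e e0; rewrite add0r.
have i1 : P.-integrable setT (EFin \o (fun=> 1 : R)).
  exact: (@probability_integrable_bounded _ _ _ _ (fun=> 1) `|1|).
have mI : measurable_fun setT (\1_A : T -> R) by exact: measurable_indic.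
have iI : P.-integrable setT (EFin \o (\1_A : T -> R)).
  apply: (@probability_integrable_bounded _ _ _ _ _ 1) => // u.
  by rewrite indicE; case: (_ \in _); rewrite ?normr1 ?normr0.
have [|x x0 kx] := kal (1 - e); first by rewrite ltrBlDr ltrDl.
have : \int[P]_u k x u <= \int[P]_u (1 - \1_A u).
  apply: le_Rintegral => //.
  - apply: (@probability_integrable_bounded _ _ _ _ _ 1); first exact: mk.
    by move=> u; have /andP[h0 h1] := k01 x u x0; rewrite ger0_norm.
  - apply: (@probability_integrable_bounded _ _ _ _ _ 1) => [|u].
      exact: measurable_funB.
    by rewrite indicE; case: (_ \in _); rewrite ?subrr ?subr0 ?normr1 ?normr0.
  move=> u _; rewrite indicE; have [/set_mem Au|_] := boolP (u \in A).
    by rewrite kA// subrr.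
  by rewrite subr0; have /andP[] := k01 x u x0.
rewrite RintegralB// Rintegral_cst_prob [X in _ - X](_ : _ = fine (P A)); last first.
  by rewrite /Rintegral integral_indic// setIT.
by move: kx; lra.
Qed.

(** Near each of the two infinities by continuity, in between by compactness
    of a segment. *)
Lemma continuous_ereal_bounded (R : realType) (f : \bar R -> R) :
  continuous f -> exists M : R, forall t, `|f t| <= M.
Proof.
move=> cf.
have [A hA] : exists A : R, forall t, (A%:E < t)%E -> `|f t| <= `|f +oo%E| + 1.
  have /cvgrPdist_le/(_ 1 ltr01)[A [_ hA]] := cf +oo%E.
  exists A => t /hA; rewrite distrC => h; rewrite -lerBlDl.
  exact: le_trans (lerB_dist _ _) h.
have [B hB] : exists B : R, forall t, (t < B%:E)%E -> `|f t| <= `|f -oo%E| + 1.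
  have /cvgrPdist_le/(_ 1 ltr01)[B [_ hB]] := cf -oo%E.
  exists B => t /hB; rewrite distrC => h; rewrite -lerBlDl.
  exact: le_trans (lerB_dist _ _) h.
have /compact_bounded[M [_ hM]] : compact ((f \o EFin) @` `[B, A]%classic).
  apply: continuous_compact; last exact: segment_compact.
  apply: continuous_subspaceT => r; apply: continuous_comp; last exact: cf.
  by move=> V.
pose K := (`|f +oo%E| + 1) + (`|f -oo%E| + 1) + (`|M| + 1).
exists K => t.
have [tA|At] := leP t A%:E; last first.
  by apply: le_trans (hA t At) _; rewrite /K -addrA lerDl !addr_ge0.
have [Bt|tB] := leP B%:E t; last first.
  by apply: le_trans (hB t tB) _; rewrite /K [X in _ <= X + _]addrC -addrA lerDl !addr_ge0.
have h : `|f t| <= `|M| + 1.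
  apply: (hM (`|M| + 1)); first by rewrite (le_lt_trans (ler_norm M))// ltrDl.
  case: t tA Bt => [r| |]//; rewrite !lee_fin => rA Br.
  by exists r => //=; rewrite in_itv /= Br.
by apply: (le_trans h); rewrite /K lerDr !addr_ge0.
Qed.

Lemma Rintegral_to_ereal (R : realType) (rho : probability R R) (f : \bar R -> R) :
  continuous f -> \int[to_ereal rho]_t f t = \int[rho]_t f t%:E.
Proof.
move=> cf; have [M fM] := continuous_ereal_bounded cf.
have mf := continuous_measurable_ereal cf.
rewrite /Rintegral integral_distribution//; first exact/measurable_EFinP.
apply: (@probability_integrable_bounded _ _ _ _ (f \o EFin) M) => [|r].
  by apply: measurableT_comp => //; exact: measurable_EFinT.
exact: fM.
Qed.

(** The limit law is constructed first; phi of this law takes the value al at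
    X = y z (1-al)/al, which is the multiplicativity of S-transforms, and the
    levels al for which this holds are all those between a0 and 1, where a0 is
    the larger of the two atoms; so the atom of the limit law at 0 is a0. *)
Lemma free_mult_limit (R : realType) (mu nu : probability R R) us vs ws :
  free_limit_setting mu nu us vs ws ->
  exists2 rho : probability R R, is_free_mult_conv mu nu rho &
    forall f : \bar R -> R, continuous f ->
      (\sum_(t <- ws n) f t) / n%:R @[n --> \oo] --> \int[to_ereal rho]_t f t.
Proof.
move=> S; have ws0 := free_list S.
have [x0 x00 acc] := free_kmean_acc S.
have [g [mg g01 gcvg]] := weak_limit_of_kmean ws0 x00 acc.
pose P := uniform_prob (@ltr01 R).
pose X := fun u : R => fine (unkern x0 (g u)).
have mX : measurable_fun setT X by exact: measurableT_comp (measurable_fine_unkern x0) mg.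
have mF (f : \bar R -> R) : continuous f -> measurable_fun setT (fun u => f (unkern x0 (g u))).
  move=> cf; apply: (@measurableT_comp _ _ _ _ _ _ (f \o unkern x0)) => //.
  apply: continuous_measurable_fun => p; apply: continuous_comp; last exact: cf.
  exact: unkern_continuous.
have kcvg x : 0 < x -> kmean (ws n) x @[n --> \oo] -->
    \int[P]_u kern x (unkern x0 (g u)).
  move=> xp; have := gcvg _ (kern_continuous xp); apply: cvg_trans.
  by apply: near_eq_cvg; apply: nearW => n; rewrite /kmean; have [-> _] := ws0 n.
have mA : measurable [set u | g u <= 0].
  rewrite (_ : mkset _ = g @^-1` `]-oo, 0]); last first.
    by apply/funext => u; rewrite /= in_itv.
  by rewrite -[X in measurable X]setTI; exact: mg.
(* g u = 0 corresponds to the point +oo *)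
have PA0 : P [set u | g u <= 0] = 0%E.
  apply: (@zero_mass_of_kern _ (measurableTypeR R) R P
    (fun x u => kern x (unkern x0 (g u))) [set u | g u <= 0]) => //.
  - by move=> x xp; apply: mF; exact: kern_continuous.
  - by move=> x u xp; rewrite kern_ge0// kern_le1.
  - by move=> x u /= gu; rewrite /unkern gu.
  move=> al al1; have [x [l [xp all xc]]] := free_kmean_near1 S al1.
  by exists x => //; rewrite (cvg_unique _ (kcvg x xp) xc).
have X0 u : 0 <= X u.
  rewrite /X /unkern; case: ifP => //= /negbT; rewrite -ltNge => gu.
  have /andP[_ g1] := g01 u.
  by apply: divr_ge0; [apply: mulr_ge0; [exact: ltW|rewrite subr_ge0]|exact: ltW].
have [rho [rhoA rhoX]] := law_exists P mX.
have rhoE (f : \bar R -> R) : continuous f ->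
    \int[P]_u f (unkern x0 (g u)) = \int[rho]_t f t%:E.
  move=> cf; have [M fM] := continuous_ereal_bounded cf.
  have mf : measurable_fun setT (f \o EFin).
    by apply: measurableT_comp; [exact: continuous_measurable_ereal|exact: measurable_EFinT].
  have := rhoX (f \o EFin) M mf (fun t => fM t%:E).
  move=> /= ->; rewrite /Rintegral; congr fine.
  apply: ae_eq_integral => //.
  - by apply/measurable_EFinP; exact: mF.
  - by apply/measurable_EFinP; exact: measurableT_comp mf mX.
  exists [set u | g u <= 0]; split=> // u /= h; rewrite leNgt; apply/negP => gu.
  by apply: h => _; rewrite /X /unkern leNgt gu.
have phirho x : 0 < x -> kmean (ws n) x @[n --> \oo] --> phi rho x.
  by move=> xp; have := kcvg x xp; rewrite rhoE//; exact: kern_continuous.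
have rho0 : on_nneg rho.
  rewrite /on_nneg rhoA (_ : _ @^-1` _ = setT); first exact: (probability_setT P).
  by apply/seteqP; split=> u //= _; exact: X0.
have level al : Num.max (atom0 mu) (atom0 nu) < al < 1 ->
    exists2 Y, 0 < Y & phi rho Y = al.
  move=> al01; have [Y Y0 Yc] := free_kmean_level S al01.
  by exists Y => //; exact: (cvg_unique _ (phirho Y Y0) Yc).
have atomE : atom0 rho = Num.max (atom0 mu) (atom0 nu).
  apply/le_anti/andP; split.
    have [a1|a1] := leP 1 (Num.max (atom0 mu) (atom0 nu)).
      by apply: le_trans a1; apply: le_trans (atom0_le_phi rho0 ltr01) (phi_le1 _ ltr01).
    apply/ler_addgt0Pr => e e0.
    have [al [al01 ale]] : exists al, Num.max (atom0 mu) (atom0 nu) < al < 1 /\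
        al <= Num.max (atom0 mu) (atom0 nu) + e.
      move: a1; set a0 := Num.max _ _ => a1.
      have [h|h] := leP ((a0 + 1) / 2) (a0 + e).
        by exists ((a0 + 1) / 2); split=> //; lra.
      by exists (a0 + e); split=> //; lra.
    have [Y Y0 Yal] := level _ al01.
    by apply: le_trans ale; rewrite -Yal; exact: atom0_le_phi.
  have H n : Num.max (atom0 mu) (atom0 nu) <= phi rho n.+1%:R^-1.
    have n0 : 0 < n.+1%:R^-1 :> R by rewrite invr_gt0.
    apply/ler_addgt0Pr => e e0; rewrite -lerBlDr.
    have be : Num.max (atom0 mu) (atom0 nu) - e < Num.max (atom0 mu) (atom0 nu).
      by rewrite ltrBlDr ltrDl.
    have := phirho _ n0 => c; apply: (ler_cvg_to _ c); first exact: cvg_cst.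
    exact: free_kmean_ge_atom0 S n0 be.
  apply: (ler_cvg_to _ (phi_cvg_atom0 rho0)); first exact: cvg_cst.
  exact: nearW.
exists rho; last first.
  by move=> f cf; rewrite Rintegral_to_ereal// -rhoE//; exact: gcvg.
split=> // s; rewrite atomE => /andP[s1 s0].
pose al := s + 1.
have al01 : Num.max (atom0 mu) (atom0 nu) < al < 1 by rewrite -ltrBlDr s1 /al; lra.
have := al01; rewrite gt_max => /andP[/andP[amu anu] al1].
have [y y0 ym] := phi_surj (left_nneg S) (introT andP (conj amu al1)).
have [z z0 zn] := phi_surj (right_nneg S) (introT andP (conj anu al1)).
have al0 : 0 < al by apply: le_lt_trans (atom0_ge0 mu) amu.
have X'0 : 0 < y * z * (1 - al) / al by rewrite divr_gt0// !mulr_gt0// subr_gt0.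
have phiX : phi rho (y * z * (1 - al) / al) = al.
  exact: (cvg_unique _ (phirho _ X'0) (free_kmean_cvg S al01 y0 z0 ym zn)).
have -> : s = al - 1 by rewrite /al addrK.
have arho : atom0 rho < 1 by rewrite atomE; case/andP: al01 => [h1 h2]; exact: lt_trans h2.
have := S_transform_phi rho0 arho X'0; rewrite phiX => ->.
have := S_transform_phi (left_nneg S) (lt_trans amu al1) y0; rewrite ym => ->.
have := S_transform_phi (right_nneg S) (lt_trans anu al1) z0; rewrite zn => ->.
by field; rewrite !gt_eqF// subr_gt0.
Qed.

(** * Application to the differential operator *)

(** The two properties of the list of zeros in [zero_list]. *)
Definition zero_list_of (R : realType) (n : nat) (p : {poly R}) (ts : seq (\bar R)) : Prop :=
  (exists2 C : R, C != 0 & forall k, (-1) ^+ k * p`_k = C * (bern_poly (bern_params ts))`_k) /\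
  forall f : \bar R -> R, measurable_fun setT f ->
    \int[zero_dist n p]_t f t = (\sum_(t <- ts) f t) / n%:R.

Lemma zero_lists (R : realType) (p : nat -> {poly R}) :
  (forall n, (0 < n)%N -> (size (p n) <= n.+1)%N) ->
  (forall n, (0 < n)%N -> nonneg_split (p n)) ->
  exists ts : nat -> seq (\bar R), (forall n, nneg_list n (ts n)) /\
    forall n, (0 < n)%N -> p n != 0 -> zero_list_of n (p n) (ts n).
Proof.
move=> psize psplit.
suff /choice[ts H] : forall n, exists s : seq (\bar R), nneg_list n s /\
    ((0 < n)%N -> p n != 0 -> zero_list_of n (p n) s).
  by exists ts; split=> [n|n n0 p0]; have [h1 h2] := H n; [|exact: h2].
move=> n; have [[n0 p0]|np] := pselect ((0 < n)%N /\ p n != 0).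
  have [s [szs s0 hC hf]] := zero_list n0 p0 (psize n n0) (psplit n n0).
  by exists s.
exists (nseq n 0%E); split; last by move=> n0 p0; exfalso; apply: np.
by split; [rewrite size_nseq|apply/allP => t /nseqP[->]].
Qed.

Lemma coef_XsubC1_exp (R : comNzRingType) (n k : nat) : (k <= n)%N ->
  (('X - 1) ^+ n : {poly R})`_k = (-1) ^+ (n - k) * 'C(n, k)%:R.
Proof.
move=> kn; rewrite addrC exprDn coef_sum (bigD1 (Ordinal (kn : k < n.+1)%N))//=.
have E i : (-1 : {poly R}) ^+ i = ((-1) ^+ i)%:P by rewrite polyC_exp polyCN.
rewrite E coefMn coefCM coefXn eqxx mulr1 big1 ?addr0 ?mulr_natr//.
move=> i ik; rewrite E coefMn coefCM coefXn.
by rewrite eq_sym (negPf (ik : (i : nat) != k)) mulr0 mul0rn.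
Qed.

Lemma zero_list_coef_gt0 (R : realType) n (p : {poly R}) ts k :
  zero_list_of n p ts -> p`_k != 0 -> 0 < (bern_poly (bern_params ts))`_k.
Proof.
move=> [[C C0 HC] _] pk; rewrite lt0r coef_bern_ge0 ?kern_in01// andbT.
apply: contra pk => /eqP ek; have := HC k; rewrite ek mulr0 => /eqP.
by rewrite mulf_eq0 signr_eq0.
Qed.

Lemma zero_list_coef_neq0 (R : realType) n (p : {poly R}) ts k :
  zero_list_of n p ts -> 0 < (bern_poly (bern_params ts))`_k -> p`_k != 0.
Proof.
move=> [[C C0 HC] _] ek; apply: contraTneq ek => pk.
have /esym/eqP := HC k; rewrite pk mulr0 mulf_eq0 (negPf C0) => /eqP ->.
by rewrite ltxx.
Qed.

(** All coefficients of (z-1)^n are binomials up to sign, so the factors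
    [diff_mult] can be read off from [T_poly]. *)
Lemma diff_iter_free_mult (R : realType) (a b l n : nat) (p : {poly R})
    (us vs ws : seq (\bar R)) d :
  (0 < n)%N -> zero_list_of n p us -> zero_list_of n (T_poly R a b n l) vs ->
  zero_list_of n (diff_iter a b l p) ws -> (diff_iter a b l p)`_d != 0 ->
  (d <= n)%N ->
  finite_free_mult n (bern_params us) (bern_params vs) (bern_params ws).
Proof.
move=> n0 [[Cp Cp0 Hp] _] [[Ct Ct0 Ht] _] zw pd dn; have [[Cd Cd0 Hd] _] := zw.
pose D : R := (n%:R ^- b) ^+ l * (-1) ^+ n.
have D0 : D != 0.
  by rewrite mulf_neq0 ?signr_eq0// expf_neq0// invr_neq0// expf_neq0// pnatr_eq0 -lt0n.
pose C := Cp * Ct / (D * Cd).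
have C0 : C != 0 by rewrite !mulf_neq0// invr_neq0// mulf_neq0.
have HC k : (k <= n)%N -> 'C(n, k)%:R * (bern_poly (bern_params ws))`_k =
    C * ((bern_poly (bern_params us))`_k * (bern_poly (bern_params vs))`_k).
  move=> kn.
  have Hw : (bern_poly (bern_params ws))`_k = Cd^-1 * ((-1) ^+ k * ((diff_mult a b l k)%:R * p`_k)).
    by rewrite -coef_diff_iter Hd mulKf.
  have Hu : (bern_poly (bern_params us))`_k = Cp^-1 * ((-1) ^+ k * p`_k) by rewrite Hp mulKf.
  have Hv : (bern_poly (bern_params vs))`_k = Ct^-1 * (D * (diff_mult a b l k)%:R * 'C(n, k)%:R).
    rewrite -[LHS](mulKf Ct0) -Ht; congr (_ * _).
    have sE : (-1) ^+ n = (-1) ^+ k * (-1) ^+ (n - k) :> R by rewrite -exprD subnKC.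
    rewrite coef_T_poly coef_XsubC1_exp// /D sE; ring.
  rewrite Hw Hu Hv /C; field.
  by rewrite Cd0 Ct0 Cp0.
exists C => //; have wd := zero_list_coef_gt0 zw pd.
have b0 : 0 < ('C(n, d)%:R : R) by rewrite ltr0n bin_gt0.
have h : 0 < C * ((bern_poly (bern_params us))`_d * (bern_poly (bern_params vs))`_d).
  by rewrite -HC// mulr_gt0.
(* C > 0 because all generating coefficients are nonnegative *)
rewrite lt0r C0 /= leNgt; apply: contraTN h => Cn.
rewrite -leNgt mulr_le0_ge0 ?(ltW Cn)// mulr_ge0 ?coef_bern_ge0 ?kern_in01//.
Qed.

Lemma size_diff_iter (R : realType) (a b l : nat) (p : {poly R}) n :
  (size p <= n)%N -> (size (diff_iter a b l p) <= n)%N.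
Proof.
move=> /leq_sizeP pn; apply/leq_sizeP => k nk.
by rewrite coef_diff_iter pn// mulr0.
Qed.

Lemma size_T_poly (R : realType) (a b n l : nat) :
  (size (T_poly R a b n l) <= n.+1)%N.
Proof.
apply/leq_sizeP => k nk; rewrite coef_T_poly [X in _ * X]nth_default ?mulr0//.
apply: leq_trans nk; have := size_exp_XsubC n (1 : R).
by rewrite polyC1 => ->.
Qed.

(** The monomial z^d with d about be n survives ell steps that each lower the
    degree by b-a as soon as be > (b-a) kappa; such a be < 1 exists because
    1 + (a-b) kappa > 0. *)
Lemma diff_mult_top (R : realType) (a b : nat) (ell : nat -> nat) (kappa al : R) :
  (ell n)%:R / n%:R @[n --> \oo] --> kappa ->
  0 < 1 + (a%:R - b%:R) * kappa -> al < 1 ->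
  exists be : R, [/\ 0 < be < 1, al <= be & \forall n \near \oo,
    forall d, be * n%:R <= d%:R -> (0 < diff_mult a b (ell n) d)%N].
Proof.
move=> ell_kappa kab al1.
pose m := Num.max (Num.max al (1 / 2)) ((b%:R - a%:R) * kappa).
have m1 : m < 1.
  by rewrite /m !gt_max al1 /= ltr_pdivrMr// mul1r ltr1n/=; move: kab; lra.
have alm : al <= m by rewrite /m !le_max lexx.
have m2 : 1 / 2 <= m by rewrite /m !le_max lexx orbT.
have mk : (b%:R - a%:R) * kappa <= m by rewrite /m !le_max lexx !orbT.
pose be := (m + 1) / 2.
have be01 : 0 < be < 1 by rewrite /be; lra.
exists be; split=> //; first by rewrite /be; lra.
pose g := (be - m) / 2; have g0 : 0 < g by rewrite /g /be; lra.
have cl : (b%:R - a%:R) * ((ell n)%:R / n%:R) @[n --> \oo] --> (b%:R - a%:R) * kappa.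
  by apply: cvgM => //; exact: cvg_cst.
near=> n => d hd.
have n0 : 0 < n%:R :> R by rewrite ltr0n; near: n; exact: nbhs_infty_gt.
have hb : b%:R / n%:R <= g by near: n; exact: near_invn_le.
have hl : (b%:R - a%:R) * ((ell n)%:R / n%:R) < m + g.
  by near: n; apply: (cvgr_lt _ cl); apply: le_lt_trans mk _; rewrite ltrDl.
move: hb; rewrite ler_pdivrMr// => hb.
have mg : m + g + g = be by rewrite /g; lra.
apply: diff_mult_gt0.
  rewrite -(ler_nat R); apply: le_trans hd; apply: (le_trans hb).
  by rewrite ler_wpM2r ?ltW// /g /be; lra.
rewrite -(ler_nat R) !natrD !natrM.
move: hl; rewrite mulrA ltr_pdivrMr// => hl.
have : (m + g) * n%:R + g * n%:R = be * n%:R by rewrite -mulrDl mg.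
move: hl hb hd; lra.
Unshelve. all: by end_near. Qed.

Lemma zero_list_kmean (R : realType) (p : nat -> {poly R})
    (ts : nat -> seq (\bar R)) (mu : probability R R) (x : R) :
  (forall n, nneg_list n (ts n)) ->
  (\forall n \near \oo, zero_list_of n (p n) (ts n)) ->
  weak_cvg (fun n => zero_dist n (p n)) (to_ereal mu) -> 0 < x ->
  kmean (ts n) x @[n --> \oo] --> phi mu x.
Proof.
move=> ts0 zl wc x0; have ck := kern_continuous x0.
have := wc _ ck; rewrite Rintegral_to_ereal// -/(phi mu x); apply: cvg_trans.
apply: near_eq_cvg; near=> n.
have [_ zf] : zero_list_of n (p n) (ts n) by near: n.
rewrite zf; last exact: continuous_measurable_ereal.
by rewrite /kmean; have [-> _] := ts0 n.
Unshelve. all: by end_near. Qed.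

Theorem theorem4p3 (R : realType) (a b : nat) (Q : nat -> {poly R})
    (nu : probability R R) (ell : nat -> nat) (kappa : R)
    (nu_abk : probability R R)
    (Q_neq0 : forall n : nat, (0 < n)%N -> Q n != 0)
    (Q_deg : forall n : nat, (0 < n)%N -> (size (Q n) <= n.+1)%N)
    (Q_roots : forall n : nat, (0 < n)%N -> nonneg_rooted (Q n))
    (nu_nneg : on_nneg nu)
    (Q_cvg : weak_cvg (fun n => zero_dist n (Q n)) (to_ereal nu))
    (ell_oo : ell n @[n --> \oo] --> \oo)
    (ell_kappa : (ell n)%:R / n%:R @[n --> \oo] --> kappa)
    (kappa_gt0 : 0 < kappa)
    (kappa_ab : 0 < 1 + (a%:R - b%:R) * kappa)
    (nu_abkP : is_nu a b kappa nu_abk) :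
  exists2 rho : probability R R,
    is_free_mult_conv nu nu_abk rho &
    weak_cvg (fun n => zero_dist n (diff_iter a b (ell n) (Q n)))
             (to_ereal rho).
Proof.
have [T_nneg _ T_cvg] := nu_abkP.
have Qsplit n : (0 < n)%N -> nonneg_split (Q n).
  by move=> n0; exact: nonneg_rooted_split (Q_roots n n0).
have [us [us0 usP]] := zero_lists Q_deg Qsplit.
have [vs [vs0 vsP]] := @zero_lists R (fun n => T_poly R a b n (ell n))
  (fun n _ => size_T_poly _ _ _ _ _) (fun n _ => nonneg_split_T_poly _ _ _ _ _).
have [ws [ws0 wsP]] := @zero_lists R (fun n => diff_iter a b (ell n) (Q n))
  (fun n n0 => size_diff_iter _ _ _ (Q_deg n n0))
  (fun n n0 => nonneg_split_diff_iter _ _ _ (Qsplit n n0)).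
have zu : \forall n \near \oo, zero_list_of n (Q n) (us n).
  by near=> n; apply: usP; [|apply: Q_neq0]; near: n; exact: nbhs_infty_gt.
have cu x : 0 < x -> kmean (us n) x @[n --> \oo] --> phi nu x.
  exact: zero_list_kmean us0 zu Q_cvg.
have zv : \forall n \near \oo, zero_list_of n (T_poly R a b n (ell n)) (vs n).
  have [be [/andP[be0 be1] _ hbe]] := diff_mult_top ell_kappa kappa_ab (ltr01 : 0 < 1 :> R).
  near=> n; have n0 : (0 < n)%N by near: n; exact: nbhs_infty_gt.
  apply: vsP => //; have cn : (0 < diff_mult a b (ell n) n)%N.
    have : forall d, be * n%:R <= d%:R -> (0 < diff_mult a b (ell n) d)%N by near: n.
    by apply; rewrite ger_pMl ?ltr0n// ltW.
  have : (T_poly R a b n (ell n))`_n != 0.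
    rewrite coef_T_poly coef_XsubC1_exp// subnn binn !mulr1 mulf_neq0//.
      by rewrite !expf_neq0// invr_neq0// expf_neq0// pnatr_eq0 -lt0n.
    by rewrite pnatr_eq0 -lt0n.
  by apply: contraNneq => ->; rewrite coef0.
have cv x : 0 < x -> kmean (vs n) x @[n --> \oo] --> phi nu_abk x.
  exact: zero_list_kmean vs0 zv (T_cvg ell ell_oo ell_kappa).
(* d is an index of a nonzero coefficient of Q n close to n, where the
   multiplier does not vanish either *)
have top (al : R) : al < 1 -> \forall n \near \oo, exists d,
    [/\ al * n%:R < d%:R, (d <= n)%N & (diff_iter a b (ell n) (Q n))`_d != 0].
  move=> al1; have [be [/andP[be0 be1] albe hbe]] := diff_mult_top ell_kappa kappa_ab al1.
  have [x x0 bx] := phi_gt_exists nu be1.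
  near=> n; have n0 : (0 < n)%N by near: n; exact: nbhs_infty_gt.
  have n0' : 0 < n%:R :> R by rewrite ltr0n.
  have hx : be < kmean (us n) x by near: n; apply: (cvgr_gt _ (cu x x0)).
  have hd : forall d, be * n%:R <= d%:R -> (0 < diff_mult a b (ell n) d)%N by near: n.
  have un : zero_list_of n (Q n) (us n) by near: n.
  have [kn kbe bek] := truncn_mean (introT andP (conj be0 be1)) n0.
  have [d kd ed] : exists2 d, (Num.truncn (be * n%:R) < d)%N &
      0 < (bern_poly (bern_params (us n)))`_d.
    apply: (coef_bern_gt0_of_mean (kern_in01 _ ltr01) x0).
    rewrite -/(bern_params _) (kmean_bern (us0 n))//; apply: le_lt_trans kbe _.
    by rewrite ltr_pM2r.
  have qd := zero_list_coef_neq0 un ed.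
  have bd : be * n%:R < d%:R.
    have bn : 0 <= be * n%:R by rewrite mulr_ge0// ltW.
    have /andP[_ h] := truncn_itv bn.
    by apply: (lt_le_trans h); rewrite ler_nat.
  exists d; split.
  - by apply: le_lt_trans bd; rewrite ler_wpM2r// ltW.
  - rewrite -ltnS; apply: leq_trans (Q_deg n n0); rewrite ltnNge; apply: contra qd => h.
    by rewrite nth_default.
  - rewrite coef_diff_iter mulf_neq0// pnatr_eq0 -lt0n.
    by apply: hd; exact: ltW.
have zw : \forall n \near \oo, zero_list_of n (diff_iter a b (ell n) (Q n)) (ws n).
  near=> n; have n0 : (0 < n)%N by near: n; exact: nbhs_infty_gt.
  have [d [_ _ pd]] : exists d,
    [/\ 0 * n%:R < d%:R :> R, (d <= n)%N & (diff_iter a b (ell n) (Q n))`_d != 0].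
    by near: n; exact: top.
  by apply: wsP => //; apply: contraNneq pd => ->; rewrite coef0.
have S : free_limit_setting nu nu_abk us vs ws.
  split=> //.
    near=> n; have n0 : (0 < n)%N by near: n; exact: nbhs_infty_gt.
    have [d [_ dn pd]] : exists d,
      [/\ 0 * n%:R < d%:R :> R, (d <= n)%N & (diff_iter a b (ell n) (Q n))`_d != 0].
      by near: n; exact: top.
    have un : zero_list_of n (Q n) (us n) by near: n.
    have vn : zero_list_of n (T_poly R a b n (ell n)) (vs n) by near: n.
    have wn : zero_list_of n (diff_iter a b (ell n) (Q n)) (ws n) by near: n.
    exact: diff_iter_free_mult n0 un vn wn pd dn.
  move=> al al1; near=> n.
  have [d [ald _ pd]] : exists d,
    [/\ al * n%:R < d%:R, (d <= n)%N & (diff_iter a b (ell n) (Q n))`_d != 0].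
    by near: n; exact: top.
  have wn : zero_list_of n (diff_iter a b (ell n) (Q n)) (ws n) by near: n.
  by exists d => //; exact: zero_list_coef_gt0 wn pd.
have [rho rhoP rhoc] := free_mult_limit S.
exists rho => // f cf; have := rhoc f cf; apply: cvg_trans.
apply: near_eq_cvg; near=> n.
have [_ zf] : zero_list_of n (diff_iter a b (ell n) (Q n)) (ws n) by near: n.
by rewrite zf//; exact: continuous_measurable_ereal.
Unshelve. all: by end_near. Qed.
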